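(* Let $K$ be a non-archimedean local field with module $q$, let $d \ge 1$, let $X = (X_1, \dots, X_d)^T$ be a Gaussian vector in $K^d$, and let $I$ be a proper subset of $\{1,\dots,d\}$. Then the maximal subsets $J = \{j_1, \dots, j_r\}$ of $\{1,\dots,d\} \setminus I$ such that $X_{j_1}, \dots, X_{j_r}$ are mutually independent given $X_I$ are the bases of an $\mathbb{F}_q$-realizable matroid with base set (ground set) $\{1,\dots,d\} \setminus I$.
   Context: A (non-archimedean) local field $K$ is a locally compact, non-discrete, totally disconnected topological field. It carries a surjective discrete valuation $\mathrm{val}: K \to \mathbb{Z} \cup \{+\infty\}$; $\mathcal{O}_K = \{x \in K : \mathrm{val}(x) \ge 0\}$ is its valuation ring, with maximal ideal $\pi\mathcal{O}_K$ where $\mathrm{val}(\pi) = 1$. The residue field $\mathcal{O}_K/\pi\mathcal{O}_K$ is finite; its cardinality $q$ is called the module of $K$. A lattice in $K^d$ is a compact $\mathcal{O}_K$-submodule of $K^d$. The Gaussian distributions on $K^d$ are exactly the normalized Haar measures (uniform probability measures) on lattices in $K^d$, and a Gaussian vector is a random vector with such a distribution. $X_I$ denotes the subvector $(X_i)_{i \in I}$, and independence given $X_I$ means conditional independence. ''Maximal'' means maximal with respect to inclusion. A matroid is $\mathbb{F}_q$-realizable if it is the matroid of linear independence of a family of vectors, indexed by its ground set, in a vector space over $\mathbb{F}_q$. *)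

(* Defs.v *)
From HB Require Import structures.
From mathcomp Require Import all_boot all_order all_algebra.
From mathcomp Require Import all_classical all_reals all_analysis.

Set Implicit Arguments.
Unset Strict Implicit.
Unset Printing Implicit Defensive.

Import Order.TTheory GRing.Theory Num.Theory.
Import numFieldNormedType.Exports.

Local Open Scope classical_set_scope.
Local Open Scope card_scope.
Local Open Scope ring_scope.

HB.mixin Record TopologicalZmodule_isTopologicalField K
    & TopologicalZmodule K & GRing.Field K := {
  fmul_continuous : continuous (fun x : K * K => x.1 * x.2) ;
  finv_continuous : forall x : K, x != 0 -> {for x, continuous (@GRing.inv K)}
}.

#[short(type="topologicalFieldType")]
HB.structure Definition TopologicalField :=
  {K of GRing.Field K & TopologicalZmodule K
      & TopologicalZmodule_isTopologicalField K}.

(* The library builds measurable types on pointed types only; the choice of the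
   point plays no role. *)
#[non_forgetful_inheritance]
HB.instance Definition _ (K : topologicalFieldType) := isPointed.Build K 0.

Definition local_field (K : topologicalFieldType) : Prop :=
  [/\ locally_compact [set: K],
      ~ (forall A : set K, open A)
    & totally_disconnected [set: K]].

(* The extended integers [\bar int] also contain -oo, which is excluded here so
   that [v] takes its values in Z and +oo. On a local field, a surjective
   discrete valuation is unique and induces the topology; [valuation_nbhs]
   records the latter. *)
Record discrete_valuation (K : topologicalFieldType) (v : K -> \bar int)
    : Prop := DiscreteValuation {
  valuationNy : forall x, v x != -oo%E ;
  valuation_eqy : forall x, v x = +oo%E <-> x = 0 ;
  valuationM : forall x y, v (x * y) = (v x + v y)%E ;
  valuationD : forall x y, (Order.min (v x) (v y) <= v (x + y)%R)%E ;
  valuation_surj : forall n : int, exists x, v x = n%:E ;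
  valuation_nbhs : forall (x : K) (A : set K),
    nbhs x A <-> exists n : int, [set y | (n%:E <= v (y - x)%R)%E] `<=` A
}.

Definition valuation_ring (K : topologicalFieldType) (v : K -> \bar int)
    : set K := [set x | (0 <= v x)%E].

(* The maximal ideal, generated by an element [pi] with [v pi = 1]. *)
Definition uniformizer_ideal (K : topologicalFieldType) (v : K -> \bar int)
    (pi : K) : set K := [set pi * x | x in valuation_ring v].

Definition is_module (K : topologicalFieldType) (v : K -> \bar int) (q : nat)
    : Prop :=
  exists2 pi : K, v pi = 1%E &
    [set [set x + y | y in uniformizer_ideal v pi] | x in valuation_ring v]
      #= `I_q.

Notation borel T := (g_sigma_algebraType (@open T)).

(* A lattice need not have full rank: {0} is a lattice. *)
Definition lattice (K : topologicalFieldType) (v : K -> \bar int) (d : nat)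
    (L : set 'cV[K]_d) : Prop :=
  [/\ compact L, L 0, (forall x y, L x -> L y -> L (x + y))
    & forall a x, valuation_ring v a -> L x -> L (a *: x)].

(* The normalized Haar measure of the compact group [L], seen as a Borel
   probability measure on K^d that is carried by [L]. *)
Definition normalized_haar (K : topologicalFieldType) (d : nat)
    (R : realType) (L : set 'cV[K]_d)
    (mu : probability (borel 'cV[K]_d) R) : Prop :=
  mu L = 1%E /\
  forall (x : 'cV[K]_d) (B : set (borel 'cV[K]_d)),
    L x -> measurable B -> B `<=` L -> mu [set x + y | y in B] = mu B.

Definition gaussian_distribution (K : topologicalFieldType)
    (v : K -> \bar int) (d : nat) (R : realType)
    (mu : probability (borel 'cV[K]_d) R) : Prop :=
  exists2 L : set 'cV[K]_d, lattice v L & normalized_haar L mu.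

Definition gaussian_vector (K : topologicalFieldType) (v : K -> \bar int)
    (d : nat) (R : realType) (disp : measure_display)
    (Omega : measurableType disp) (P : probability Omega R)
    (X : {RV P >-> borel 'cV[K]_d}) : Prop :=
  gaussian_distribution v (distribution P X).

(* [f] is a version of the conditional probability P(A | Y), i.e. of the
   conditional expectation of the indicator of [A] given the sigma-algebra
   generated by [Y]. *)
Definition conditional_probability (disp disp' : measure_display)
    (Omega : measurableType disp) (S : measurableType disp') (R : realType)
    (P : probability Omega R) (Y : Omega -> S) (A : set Omega)
    (f : Omega -> R) : Prop :=
  [/\ measurable_fun [set: g_sigma_algebra_preimageType Y]
        (f : g_sigma_algebra_preimageType Y -> R),
      P.-integrable [set: Omega] (EFin \o f)
    & forall C : set Omega, g_sigma_algebra_preimage Y C ->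
        (\int[P]_(w in C) (f w)%:E)%E = P (A `&` C)].

(* P(Z_j \in B_j for all j in J | Y) = prod_(j in J) P(Z_j \in B_j | Y) almost
   surely, for all measurable B_j. Versions exist and are unique up to null
   sets, so the equality says that the product of any versions of the factors
   is a version of the left-hand side. *)
Definition conditionally_independent
    (disp disp' disp'' : measure_display) (Omega : measurableType disp)
    (S : measurableType disp') (T : measurableType disp'') (R : realType)
    (P : probability Omega R) (N : finType) (J : {set N})
    (Z : N -> Omega -> T) (Y : Omega -> S) : Prop :=
  forall (B : N -> set T) (p : N -> Omega -> R),
    (forall j, j \in J -> measurable (B j)) ->
    (forall j, j \in J ->
       conditional_probability P Y (Z j @^-1` B j) (p j)) ->
    conditional_probability P Y
      (\bigcap_(j in [set` J]) (Z j @^-1` B j))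
      (fun w => \prod_(j in J) p j w).

Definition component (K : topologicalFieldType) (d : nat) (Omega : Type)
    (X : Omega -> 'cV[K]_d) (j : 'I_d) : Omega -> borel K :=
  fun w => X w j 0.

Definition subvector (K : topologicalFieldType) (d : nat) (Omega : Type)
    (X : Omega -> 'cV[K]_d) (I : {set 'I_d})
    : Omega -> borel 'cV[K]_#|I| :=
  fun w => \col_(k < #|I|) X w (enum_val k) 0.

Definition independent_given (K : topologicalFieldType) (d : nat)
    (R : realType) (disp : measure_display) (Omega : measurableType disp)
    (P : probability Omega R) (X : Omega -> 'cV[K]_d) (I J : {set 'I_d})
    : Prop :=
  conditionally_independent P J (component X) (subvector X I).

Record matroid (T : finType) (E : {set T}) := Matroid {
  indep : {set {set T}} ;
  indep_ground : forall A : {set T}, A \in indep -> A \subset E ;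
  indep0 : finset.set0 \in indep ;
  indepS : forall A B : {set T}, B \in indep -> A \subset B -> A \in indep ;
  indep_augment : forall A B : {set T}, A \in indep -> B \in indep ->
    (#|A| < #|B|)%N -> exists2 x, x \in B :\: A & x |: A \in indep
}.

Definition bases (T : finType) (E : {set T}) (M : matroid E)
    : {set {set T}} := [set B : {set T} | maxset [in indep M] B]%SET.

(* Only the values of [u] on the ground set [E] matter. *)
Definition Fq_realizable (q : nat) (T : finType) (E : {set T})
    (M : matroid E) : Prop :=
  exists (F : finFieldType) (V : vectType F) (u : T -> V),
    #|F| = q /\
    forall A : {set T}, A \subset E ->
      (A \in indep M) = free [seq u i | i in A].

(* Main.v *)
Require Import Defs.
From HB Require Import structures.
From mathcomp Require Import all_boot all_order all_algebra.
From mathcomp Require Import all_classical all_reals all_analysis.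
From mathcomp Require Import measurable_realfun ring zify.

(** Let [L] be the lattice of [X] and [L0] the set of [z] in [L] with [z_I = 0].
    The law of [X] is invariant under translation by [L0], which does not move
    [X_I]. Hence, given [X_I], the event that [X_j] lies in a ball has
    probability [1 / N] on a coset of [H_j + pi^n O] and [0] off it, where
    [H_j] is the projection of [L0] to the [j]-th coordinate and [N] is the index
    of [pi^n O] in [H_j + pi^n O]. So the [X_j] with [j] in [J] are independent
    given [X_I] iff the projection of [L0] to [K^J] is the whole product of the
    [H_j]. Write [H_j = t_j O]. By successive approximation modulo [pi] and
    compactness of [L0], the projection is the whole product iff the reductions
    modulo [pi] of the functionals [y_j / t_j] on [L0], for [j] in [J], are
    linearly independent over the residue field. A coordinate with [t_j = 0] is
    constant given [X_I], hence independent of everything: it is a coloop. *)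

Set Implicit Arguments.
Unset Strict Implicit.
Unset Printing Implicit Defensive.

Import Order.TTheory GRing.Theory Num.Theory.
Import numFieldNormedType.Exports.

Local Open Scope classical_set_scope.
Local Open Scope ring_scope.

(** Membership in the ball pi^n O. It is boolean so that it can be used under [has] and [pairwise]
    on finite sequences of representatives. *)
Definition vge (K : topologicalFieldType) (v : K -> \bar int) (n : int) (x : K)
  : bool := (n%:E <= v x)%E.

(** * The topology defined by a valuation *)

Section Valuation.
Variables (K : topologicalFieldType) (v : K -> \bar int).
Hypothesis hv : discrete_valuation v.

Lemma val_fin (x : K) : x != 0 -> exists n : int, v x = n%:E.
Proof.
move=> x0; case E : (v x) => [n| |]; first by exists n.
- by have /(valuation_eqy hv) x00 := E; rewrite x00 eqxx in x0.
- by have := valuationNy hv x; rewrite E.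
Qed.

Lemma val1 : v 1 = 0%E.
Proof.
have [n E] := val_fin (oner_neq0 K).
have := valuationM hv 1 1; rewrite mulr1 E -EFinD => -[] /eqP.
by rewrite -subr_eq0 opprD addNKr oppr_eq0 => /eqP ->.
Qed.

Lemma valN (x : K) : v (- x) = v x.
Proof.
have N1 : (-1 : K) != 0 by rewrite oppr_eq0 oner_neq0.
have [n E] := val_fin N1.
have := valuationM hv (-1) (-1); rewrite mulrNN mulr1 val1 E -EFinD => -[] /eqP.
rewrite eq_sym -mulr2n mulrn_eq0 /= => /eqP n0.
by rewrite -mulN1r (valuationM hv) E n0 add0e.
Qed.

Lemma vge0 n : vge v n 0.
Proof. by rewrite /vge (valuation_eqy hv 0).2 // leey. Qed.

Lemma vgeN n x : vge v n (- x) = vge v n x.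
Proof. by rewrite /vge valN. Qed.

Lemma vgeD n x y : vge v n x -> vge v n y -> vge v n (x + y).
Proof.
by rewrite /vge => hx hy; apply: le_trans (valuationD hv x y); rewrite le_min hx.
Qed.

Lemma vgeB n x y : vge v n x -> vge v n y -> vge v n (x - y).
Proof. by move=> hx hy; apply: vgeD; rewrite ?vgeN. Qed.

Lemma vgeW m n x : m <= n -> vge v n x -> vge v m x.
Proof. by move=> mn; apply: le_trans; rewrite lee_fin. Qed.

Lemma vgeM m n x y : vge v m x -> vge v n y -> vge v (m + n) (x * y).
Proof. by rewrite /vge (valuationM hv) EFinD; apply: leeD. Qed.

Lemma vge_eq0 x : (forall n : nat, vge v n%:Z x) -> x = 0.
Proof.
move=> h; apply/eqP; apply: contrapT => /negP /val_fin [n E].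
have := h `|n|.+1; rewrite /vge E lee_fin; apply/negP; rewrite -ltNge.
by apply: le_lt_trans (ler_norm n) _; rewrite -abszE ltz_nat.
Qed.

Lemma vge_exists (x : K) : exists N : nat, vge v (- N%:Z) x.
Proof.
have [->|/val_fin [a E]] := eqVneq x 0; first by exists 0%N; exact: vge0.
by exists `|a|%N; rewrite /vge E lee_fin lerNl abszE -normrN ler_norm.
Qed.

Lemma vge_trans n x y z : vge v n (x - y) -> vge v n (y - z) -> vge v n (x - z).
Proof. by move=> h1 h2; have := vgeD h1 h2; rewrite addrA subrK. Qed.

Lemma vge_sym n x y : vge v n (x - y) = vge v n (y - x).
Proof. by rewrite -vgeN opprB. Qed.

Lemma vge_unscale n m t x : v t = m%:E -> vge v (m + n) (t * x) = vge v n x.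
Proof.
by move=> tm; rewrite /vge (valuationM hv) tm EFinD leeD2lE.
Qed.

Lemma nbhs_vge (x : K) (A : set K) :
  nbhs x A <-> exists n : nat, forall y, vge v n%:Z (y - x) -> A y.
Proof.
rewrite (valuation_nbhs hv); split=> -[n h].
  exists `|n|%N => y hy; apply: h => /=; apply: vgeW hy.
  by rewrite abszE ler_norm.
by exists n.
Qed.

Lemma open_vball (a : K) n : open [set x | vge v n (x - a)].
Proof.
rewrite openE => x /= hx; apply/(valuation_nbhs hv); exists n => y /= hy.
exact: vge_trans hy hx.
Qed.

Lemma nbhs_vge_mx d (x : 'cV[K]_d) (A : set 'cV[K]_d) :
  nbhs x A <->
  exists n : nat, forall y : 'cV[K]_d,
    (forall i, vge v n%:Z (y i 0 - x i 0)) -> A y.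
Proof.
split=> [[B hB BA]|[n h]].
  have /choice [f hf] i : exists n : nat, forall y,
      vge v n%:Z (y - x i 0) -> B i 0 y.
    by apply/nbhs_vge/hB.
  exists (\max_i f i)%N => y hy; apply: BA => i j; rewrite ord1; apply: hf.
  by apply: vgeW (hy i); rewrite lez_nat leq_bigmax.
exists (fun i j => [set z | vge v n%:Z (z - x i j)]).
  by move=> i j; apply/nbhs_vge; exists n.
by move=> y hy; apply: h => i; apply: hy.
Qed.

Lemma hausdorff_mx d : hausdorff_space 'cV[K]_d.
Proof.
move=> x y xy; apply/matrixP => i j; rewrite ord1; apply/eqP.
rewrite -subr_eq0; apply/eqP/vge_eq0 => n.
have [||z [hz1 hz2]] := xy [set z | forall i, vge v n%:Z (z i 0 - x i 0)]
   [set z | forall i, vge v n%:Z (z i 0 - y i 0)].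
- by apply/nbhs_vge_mx; exists n.
- by apply/nbhs_vge_mx; exists n.
by apply: vge_trans (hz2 i); rewrite vge_sym.
Qed.

Lemma open_vball_mx d (a : 'cV[K]_d) n :
  open [set x : 'cV[K]_d | forall i, vge v n (x i 0 - a i 0)].
Proof.
rewrite openE => x /= hx; apply/nbhs_vge_mx; exists `|n|%N => y hy i.
apply: vge_trans (hx i); apply: vgeW (hy i); by rewrite abszE ler_norm.
Qed.

Lemma vball0_mx d n : [set x : 'cV[K]_d | forall i, vge v n (x i 0)] =
  [set x : 'cV[K]_d | forall i, vge v n (x i 0 - (0 : 'cV[K]_d) i 0)].
Proof. by apply/seteqP; split=> x h i; have := h i; rewrite mxE subr0. Qed.

Lemma open_vball0_mx d n : open [set x : 'cV[K]_d | forall i, vge v n (x i 0)].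
Proof. by rewrite vball0_mx; exact: open_vball_mx. Qed.

End Valuation.

(** * Compactness, finite nets and countable unions of balls *)

Lemma compact_net (T : ptopologicalType) (A : set T) (U : T -> set T) :
  compact A -> (forall x, open (U x)) -> (forall x, U x x) ->
  exists2 s : seq T, (forall x, x \in s -> A x) &
    forall z, A z -> exists2 x, x \in s & U x z.
Proof.
rewrite compact_cover => cA oU Ux.
have [|D DA cov] := cA T A U (fun x _ => oU x); first by move=> x Ax; exists x.
exists (finmap.enum_fset D) => [x xD|z Az].
  by have := DA x xD; rewrite inE.
by have [x xD Uz] := cov z Az; exists x.
Qed.

Section Compactness.
Variables (K : topologicalFieldType) (v : K -> \bar int).
Hypothesis hv : discrete_valuation v.

Lemma compact_net_mx d (L : set 'cV[K]_d) (n : int) : compact L ->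
  exists2 s : seq 'cV[K]_d, (forall x, x \in s -> L x) &
    forall z, L z -> exists2 x, x \in s & forall i, vge v n (z i 0 - x i 0).
Proof.
move=> cL; apply: (@compact_net _ L
  (fun a => [set x : 'cV[K]_d | forall i, vge v n (x i 0 - a i 0)])) => //.
  by move=> x; apply: open_vball_mx.
by move=> x i; rewrite subrr vge0.
Qed.

(** The solutions modulo pi^n form a decreasing sequence of nonempty subsets of the compact set [L].
    A cluster point of the filter they generate agrees with [h] to every precision. *)
Lemma compact_approx d (L : set 'cV[K]_d) (A : pred 'I_d) (h : 'I_d -> K) :
  compact L ->
  (forall n : nat, exists2 y, L y & forall i, A i -> vge v n%:Z (y i 0 - h i)) ->
  exists2 y, L y & forall i, A i -> y i 0 = h i.
Proof.
move=> cL hL.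
pose S (n : nat) := L `&` [set y | forall i, A i -> vge v n%:Z (y i 0 - h i)].
have fF : Filter (filter_from setT S).
  apply: filter_from_filter; first by exists 0%N.
  move=> m n _ _; exists (maxn m n) => // y [Ly hy]; split; split=> // i Ai.
    by apply: vgeW (hy i Ai); rewrite lez_nat leq_maxl.
  by apply: vgeW (hy i Ai); rewrite lez_nat leq_maxr.
have pF : ProperFilter (filter_from setT S).
  apply: filter_from_proper => n _; have [y Ly hy] := hL n; exists y.
  by split.
have [|y [Ly cy]] := cL (filter_from setT S) pF; first by exists 0%N => // y [].
exists y => // i Ai; apply/eqP; rewrite -subr_eq0; apply/eqP/(vge_eq0 hv) => n.
have [||z [[Lz hz] hzy]] := cy (S n)
  [set z : 'cV[K]_d | forall i, vge v n%:Z (z i 0 - y i 0)].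
- by exists n.
- by apply/(nbhs_vge_mx hv); exists n.
by apply: vge_trans (hz i Ai) => //; rewrite vge_sym.
Qed.

Hypothesis hK : local_field K.

(** A compact neighbourhood of 0 contains some pi^m O. Multiplication by an element of valuation m +
    N sends pi^(-N) O into it, so a finite net there pulls back to a finite net of pi^(-N) O; these
    sets exhaust K as N grows. *)
Lemma countable_net (n : int) :
  exists c : nat -> K, forall x, exists k, vge v n (x - c k).
Proof.
have [lc _ _] := hK.
have [A nA [cA clA]] := lc (0 : K) Logic.I.
have {nA} [m Am] : exists m : nat, forall y, vge v m%:Z y -> A y.
  have {}nA : nbhs (0 : K) A.
    by move: nA; rewrite /within /prop_near1 /=; apply: filterS => x; apply.
  by have [m hm] := (nbhs_vge hv _ _).1 nA; exists m => y hy; apply: hm; rewrite subr0.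
have net (N : nat) : exists s : seq K, forall x, vge v (- N%:Z) x ->
    exists2 c, c \in s & vge v n (x - c).
  have [t vt] := valuation_surj hv (m%:Z + N%:Z).
  have t0 : t != 0.
    by apply/eqP => t0; move: vt; rewrite t0 (valuation_eqy hv 0).2.
  have ballx x : vge v (m%:Z + N%:Z + n) (x - x) by rewrite subrr vge0.
  have [s _ hs] := @compact_net K A
    (fun a => [set x | vge v (m%:Z + N%:Z + n) (x - a)]) cA
    (fun a => open_vball hv a _) ballx.
  exists [seq x / t | x <- s] => x hx.
  have [|a /= as_ ha] := hs (t * x).
    apply: Am; have := hx; rewrite -(vge_unscale hv _ _ vt).
    by rewrite addrK.
  exists (a / t); first by apply/mapP; exists a.
  by rewrite -(vge_unscale hv _ _ vt) mulrBr mulrCA divff // mulr1.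
have /choice [s hs] := net.
(* The index codes a pair: the size N of the ball and a position in its net. Indices that code no
   pair get the value 0. *)
pose c k := if @unpickle (nat * nat)%type k is Some p then nth 0 (s p.1) p.2 else 0.
exists c => x.
have [N hN] := vge_exists hv x.
have [a /(nthP 0) [k _ <-] hxa] := hs N x hN.
by exists (pickle (N, k)); rewrite /c pickleK.
Qed.

(** The balls centred at the points of the nets, for all radii, form a countable base: a ball is
    centred at each of its points, so every small ball around a point of [U] is one of them. [D]
    selects those contained in [U]. *)
Lemma open_countable_vballs (U : set K) : open U ->
  exists a : nat -> K, exists r : nat -> nat, exists D : set nat,
  U = \bigcup_(k in D) [set x | vge v (r k)%:Z (x - a k)].
Proof.
move=> oU; have /choice [c hc] := fun n : nat => countable_net n%:Z.
pose p k := odflt (0%N, 0%N) (@unpickle (nat * nat)%type k).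
exists (fun k => c (p k).1 (p k).2), (fun k => (p k).1).
exists [set k | [set x | vge v (p k).1%:Z (x - c (p k).1 (p k).2)] `<=` U].
apply/seteqP; split=> [x Ux|x [k /= sub hx]]; last exact: sub.
move: oU; rewrite openE => /(_ x Ux) /(nbhs_vge hv) [n hn].
have [k hk] := hc n x; exists (pickle (n, k)); rewrite /p /= pickleK //=.
move=> y /= hy; apply: hn; apply: (vge_trans hv hy); by rewrite vge_sym.
Qed.

End Compactness.

(** * Conditional probabilities *)

Section ConditionalProbability.
Context (disp disp' : measure_display) (Omega : measurableType disp)
  (S : measurableType disp') (R : realType) (P : probability Omega R).
Variable Y : Omega -> S.
Hypothesis mY : measurable_fun setT Y.

Local Notation OY := (g_sigma_algebra_preimageType Y).
Local Notation sY := (g_sigma_algebra_preimage Y).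

Lemma measurable_preimage C : sY C -> measurable C.
Proof. by move=> [D mD <-]; apply: mY. Qed.

Lemma measurable_fun_preimage d' (U : measurableType d') (f : Omega -> U) :
  measurable_fun [set: OY] (f : OY -> U) -> measurable_fun setT f.
Proof. by move=> mf _ B mB; apply: measurable_preimage; apply: mf. Qed.

Lemma g_sigma_algebra_preimageI C D : sY C -> sY D -> sY (C `&` D).
Proof. exact: (@measurableI _ OY). Qed.

Import HBNNSimple.

(* Both sides agree for indicators of events of the sigma-algebra of [Y], by
   definition of [p]; the general case follows by approximation of [f]. *)
Lemma integral_conditional_probability (A C : set Omega) (f p : Omega -> R) :
  measurable A -> sY C ->
  conditional_probability P Y A p -> (forall w, 0 <= p w) ->
  measurable_fun [set: OY] (f : OY -> R) -> (forall w, 0 <= f w) ->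
  (\int[P]_(w in C) ((f w)%:E * (p w)%:E) = \int[P]_(w in C `&` A) (f w)%:E)%E.
Proof.
move=> mA sC [mp ip hp] p0 mf f0.
have mC := measurable_preimage sC.
have mCA : measurable (C `&` A) by exact: measurableI.
have mp' := measurable_fun_preimage mp.
have mfE := (measurable_EFinP _ _).2 mf.
(* The simple functions are taken for the sigma-algebra of [Y], so that their level sets are events
   to which the defining identity of [p] applies. *)
pose h' := nnsfun_approx (@measurableT _ OY) mfE.
pose h n : Omega -> R := h' n.
have mh n : measurable_fun setT (h n).
  exact: (@measurable_fun_preimage _ _ (h' n)).
have hcvg w : (EFin \o h^~ w) n @[n --> \oo] --> (f w)%:E.
  by apply: (@cvg_nnsfun_approx _ OY R setT _ _ mfE) => // x _; rewrite lee_fin.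
have hnd w : {homo h^~ w : m n / (m <= n)%N >-> (m <= n)%R}.
  by move=> m n mn; have /lefP := nd_nnsfun_approx (@measurableT _ OY) mfE mn; apply.
have h0 n w : 0 <= h n w by [].
have hfin n : finite_set (range (h n)) by exact: (fimfunP (h' n)).
have sr n r : sY (h n @^-1` [set r]).
  exact: (@measurable_sfunP _ _ OY _ (h' n)).
have hE n w : h n w = \sum_(y \in range (h n)) y * \1_(h n @^-1` [set y]) w.
  exact: (fimfunE (h' n) w).
have nn n y (w : Omega) : (0 <= (y * \1_(h n @^-1` [set y]) w)%:E :> \bar R)%E.
  by rewrite EFinM; exact: (nnfun_muleindic_ge0 (h' n)).
clearbody h; clear h'.
have key n : (\int[P]_(w in C) ((h n w)%:E * (p w)%:E)
            = \int[P]_(w in C `&` A) (h n w)%:E)%E.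
  have mr r := measurable_preimage (sr n r).
  have E w : (h n w)%:E =
     (\sum_(y \in range (h n)) (y * \1_(h n @^-1` [set y]) w)%:E)%E.
    by rewrite [in LHS]hE -fsumEFin.
  have indich r D : measurable D ->
      measurable_fun D (fun x => (r * \1_(h n @^-1` [set r]) x)%:E).
    move=> mD; apply/measurable_EFinP/measurable_funTS.
    by apply: measurable_funM => //; exact: measurable_indic.
  transitivity (\int[P]_(w in C) (\sum_(y \in range (h n))
     ((y * \1_(h n @^-1` [set y]) w)%:E * (p w)%:E))%E)%E.
    by apply: eq_integral => w _; rewrite {1}E ge0_mule_fsuml.
  rewrite ge0_integral_fsum//; last 2 first.
  - move=> y; apply: emeasurable_funM; first exact: indich.
    by apply/measurable_funTS/measurable_EFinP.
  - by move=> y w _; rewrite mule_ge0// lee_fin.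
  under [in RHS]eq_integral do rewrite E.
  rewrite ge0_integral_fsum//; last by move=> y; apply: indich.
  apply: eq_fsbigr => y; rewrite inE => -[w0 _ hy].
  have y0 : 0 <= y by rewrite -hy.
  under eq_integral do rewrite EFinM -muleA.
  under [in RHS]eq_integral do rewrite EFinM.
  have mi D : measurable_fun D (fun w => (\1_(h n @^-1` [set y]) w)%:E : \bar R).
    by apply/measurable_EFinP/measurable_funTS; exact: measurable_indic.
  rewrite !ge0_integralZl//; last 2 first.
  - apply: emeasurable_funM => //; exact/measurable_EFinP/measurable_funTS.
  - by move=> w _; rewrite mule_ge0// lee_fin.
  congr (_ * _)%E.
  rewrite integral_indic//.
  transitivity (\int[P]_(w in C `&` (h n @^-1` [set y])) (p w)%:E)%E.
    rewrite integral_mkcondr; apply: eq_integral => w _.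
    by rewrite epatch_indic muleC.
  rewrite hp; last exact: g_sigma_algebra_preimageI.
  by congr (P _); rewrite setIA setIC [A `&` C]setIC.
transitivity (limn (fun n => \int[P]_(w in C) ((h n w)%:E * (p w)%:E)))%E.
  rewrite -monotone_convergence//.
  - apply: eq_integral => w _; apply/esym/cvg_lim => //.
    by apply: cvgeZr => //; exact: hcvg.
  - move=> n; apply: emeasurable_funM; apply/measurable_EFinP/measurable_funTS => //.
  - by move=> n w _; rewrite mule_ge0// lee_fin.
  - by move=> w _ m n mn; rewrite lee_wpmul2r ?lee_fin//; exact: hnd.
under eq_fun do rewrite key.
rewrite -monotone_convergence//.
- apply: eq_integral => w _; apply/cvg_lim => //; exact: hcvg.
- by move=> n; apply/measurable_EFinP/measurable_funTS.
- by move=> n w _; rewrite lee_fin.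
- by move=> w _ m n mn; rewrite lee_fin; exact: hnd.
Qed.

(** The event C = {p < 0} belongs to the sigma-algebra of [Y], so the integral of p over it is a
    probability. Hence the integral of |p| = -p over C is at most 0, and p vanishes almost
    everywhere on C. *)
Lemma conditional_probability_ae_ge0 (A : set Omega) (p : Omega -> R) :
  measurable A ->
  conditional_probability P Y A p -> P.-negligible [set w | p w < 0].
Proof.
move=> mA [mp ip hp].
have mp' := measurable_fun_preimage mp.
set C := [set w | p w < 0].
have sC : sY C.
  rewrite (_ : C = setT `&` (p @^-1` `]-oo, 0[)).
    by apply: mp => //; exact: measurable_itv.
  by rewrite setTI; apply/seteqP; split=> w; rewrite /C /= in_itv.
have mC := measurable_preimage sC.
have ipC : P.-integrable C (EFin \o p) by apply: integrableS ip.
have /ae_eq_integral_abs : (\int[P]_(w in C) `|(EFin \o p) w| = 0)%E.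
  apply/eqP; rewrite eq_le; apply/andP; split; last first.
    by apply: integral_ge0 => w _.
  rewrite (_ : (\int[P]_(w in C) _)%E = (\int[P]_(w in C) - (EFin \o p) w)%E).
    rewrite integralN; last exact: integrable_add_def.
    by rewrite hp// oppe_le0.
  by apply: eq_integral => w; rewrite inE => /ltW pw /=; rewrite ler0_norm.
case=> //.
  by apply/measurable_funTS/measurable_EFinP.
move=> N [mN PN sub]; exists N; split=> // w Cw; apply: sub => /= /(_ Cw) [] /eqP.
by rewrite lt_eqF.
Qed.

(** Replaces an arbitrary version by an everywhere nonnegative one, as the integration of
    nonnegative functions requires. *)
Lemma conditional_probability_max0 (A : set Omega) (p : Omega -> R) :
  measurable A -> conditional_probability P Y A p ->
  conditional_probability P Y A (fun w => Num.max (p w) 0).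
Proof.
move=> mA cp; have [N [mN PN sub]] := conditional_probability_ae_ge0 mA cp.
have [mp ip hp] := cp; have mp' := measurable_fun_preimage mp.
have mq : measurable_fun setT (fun w => Num.max (p w) 0).
  by apply: measurable_maxr => //; exact: measurable_cst.
have ae (D : set Omega) : ae_eq P D (EFin \o p) (EFin \o (fun w => Num.max (p w) 0)).
  exists N; split => // w /= /not_implyP[_ hw]; apply: sub => /=.
  by rewrite ltNge; apply/negP => p0; apply: hw; rewrite max_l.
split.
- by apply: measurable_maxr => //; exact: measurable_cst.
- apply/integrableP; split; first exact/measurable_EFinP.
  have /integrableP[_] := ip; apply: le_lt_trans.
  apply: ge0_le_integral => //.
  + by apply: measurableT_comp => //; exact/measurable_EFinP.
  + by apply: measurableT_comp => //; exact/measurable_EFinP.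
  + by move=> w _ /=; rewrite lee_fin; case: (leP 0 (p w)) => //; rewrite normr0.
move=> C sC; rewrite -hp//; apply/esym/ae_eq_integral => //.
- exact: measurable_preimage.
- by apply/measurable_funTS/measurable_EFinP.
- by apply/measurable_funTS/measurable_EFinP.
Qed.

End ConditionalProbability.

(** * Borel measures on a local field *)

(** Turns an integral over the event that a coordinate lies in [B] into a measure in [B], so that
    uniqueness of measures can be applied. *)
Lemma pushforward_density (d d' : measure_display) (T : measurableType d)
    (T' : measurableType d') (R : realType) (P : {measure set T -> \bar R})
    (g : T -> T') (C : set T) (f : T -> \bar R) :
  measurable_fun setT g -> measurable C -> measurable_fun setT f ->
  (forall x, 0 <= f x)%E ->
  exists m : {measure set T' -> \bar R},
    forall B, m B = (\int[P]_(x in C `&` g @^-1` B) f x)%E.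
Proof.
move=> mg mC mf f0.
pose m B := (\int[P]_(x in C `&` g @^-1` B) f x)%E.
have m0 : m set0 = 0%E by rewrite /m preimage_set0 setI0 integral_set0.
have m_ge0 B : (0 <= m B)%E by apply: integral_ge0.
have mgB B : measurable B -> measurable (C `&` g @^-1` B).
  by move=> mB; apply: measurableI => //; rewrite -[X in measurable X]setTI; exact: mg.
have m_sigma : semi_sigma_additive m.
  move=> F mF tF mUF; rewrite /m; apply: cvg_toP.
    apply: ereal_nondecreasing_is_cvgn => k n kn.
    by apply: lee_sum_nneg_natr => // i _ _; apply: integral_ge0.
  rewrite preimage_bigcup setI_bigcupr ge0_integral_bigcup//=.
  - by move=> k; exact: mgB.
  - exact: measurable_funTS.
  apply/trivIsetP => i j _ _ ij; rewrite setIACA -preimage_setI.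
  by rewrite ((trivIsetP.1 tF) _ _ _ _ ij)// preimage_set0 setI0.
by exists (HB.pack_for {measure set T' -> \bar R} m
  (isMeasure.Build _ _ _ m m0 m_ge0 m_sigma)).
Qed.

Lemma continuous_borel (T U : ptopologicalType) (f : T -> U) : continuous f ->
  measurable_fun [set: borel T] (f : borel T -> borel U).
Proof.
move=> cf; apply: (@measurability _ _ (borel T) (borel U) setT f (@open U)) => //.
move=> _ [B oB <-].
by rewrite setTI; apply: sub_sigma_algebra; exact: open_comp.
Qed.

Lemma closed_borel (T : ptopologicalType) (A : set T) :
  closed A -> measurable (A : set (borel T)).
Proof.
move=> cA; rewrite -[A]setCK; apply: measurableC.
by apply: sub_sigma_algebra; exact: closed_openC.
Qed.

Section Borel.
Variables (K : topologicalFieldType) (v : K -> \bar int).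
Hypothesis hv : discrete_valuation v.

Lemma coord_continuous_mx d (j : 'I_d) : continuous (fun x : 'cV[K]_d => x j 0).
Proof.
move=> x A /= /(nbhs_vge hv)[n hn]; apply/(nbhs_vge_mx hv); exists n => y hy /=.
exact: hn.
Qed.

(** [subvector X I] is convertible to the composite of [restrict_col I] and [X]; measurability of
    X_I thus follows from continuity of the restriction. *)
Definition restrict_col d (I : {set 'I_d}) (x : 'cV[K]_d) : 'cV[K]_#|I| :=
  \col_(k < #|I|) x (enum_val k) 0.

Lemma restrict_col_continuous d (I : {set 'I_d}) : continuous (@restrict_col d I).
Proof.
move=> x A /= /(nbhs_vge_mx hv)[n hn]; apply/(nbhs_vge_mx hv).
by exists n => y hy /=; apply: hn => i; rewrite !mxE.
Qed.

Lemma translation_continuous d (a : 'cV[K]_d) :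
  continuous (fun x : 'cV[K]_d => x + a).
Proof.
move=> x A /= /(nbhs_vge_mx hv)[n hn]; apply/(nbhs_vge_mx hv).
by exists n => y hy /=; apply: hn => i; rewrite !mxE opprD addrACA subrr addr0.
Qed.

Lemma measurable_vball (a : K) n :
  measurable ([set x | vge v n (x - a)] : set (borel K)).
Proof. by apply: sub_sigma_algebra; exact: open_vball. Qed.

Hypothesis hK : local_field K.

(** Two balls are nested or disjoint, so the balls and the empty set are stable under intersection.
    They generate the Borel sets because open sets are countable unions of balls, and finite
    measures that agree on such a class are equal. *)
Lemma borel_measure_unique (R : realType) (m1 m2 : {measure set (borel K) -> \bar R}) :
  (forall a n, m1 [set x | vge v n (x - a)] = m2 [set x | vge v n (x - a)]) ->
  (m1 setT < +oo)%E ->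
  forall B : set (borel K), measurable B -> m1 B = m2 B.
Proof.
move=> m12 m1fin B mB.
pose G : set (set (borel K)) :=
  [set A | A = set0 \/ exists a n, A = [set x | vge v n (x - a)]].
have Gm : G `<=` measurable.
  by move=> _ [->|[a [n ->]]]; [exact: measurable0|exact: measurable_vball].
have sG : <<s G >> B.
  have sub : @open K `<=` <<s G >>.
    move=> U oU; have [a [r [D ->]]] := open_countable_vballs hv hK oU.
    rewrite bigcup_mkcond.
    apply: (@bigcupT_measurable _ (g_sigma_algebraType G)) => k.
    by apply: sub_sigma_algebra; case: ifP => _; [right; exists (a k), (r k)%:Z|left].
  suff : <<s @open K >> `<=` <<s G >> by apply.
  exact: (smallest_sub (smallest_sigma_algebra _ _) sub).
(* The uniqueness theorem asks for an exhaustion by members of [G] of finite measure: the balls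
   pi^(-k) O. *)
apply: (g_sigma_algebra_measure_unique G Gm
  (fun k => [set x | vge v (- k%:Z) (x - 0)])) => //.
- by move=> i; right; exists 0, (- i%:Z).
- apply/seteqP; split=> // x _; have [N hN] := vge_exists hv x.
  by exists N => //=; rewrite subr0.
- move=> A1 A2 [->|[a [n ->]]]; first by rewrite set0I; left.
  move=> [->|[b [m ->]]]; first by rewrite setI0; left.
  wlog mn : a b m n / m <= n => [hw|].
    case: (leP m n) => [|/ltW] h; first exact: hw.
    by rewrite setIC; exact: hw.
  have [ab|nab] := boolP (vge v m (a - b)).
    right; exists a, n; apply/seteqP; split=> x /=; first by case.
    move=> xa; split=> //; apply: (vge_trans hv _ ab).
    exact: vgeW xa.
  left; apply/seteqP; split=> x //= [xa xb]; move/negP: nab; apply.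
  apply: (vge_trans hv _ xb); rewrite (vge_sym hv); exact: vgeW xa.
- by move=> _ [->|[a [n ->]]]; rewrite ?measure0.
- by move=> k; apply: le_lt_trans m1fin; apply: le_measure; rewrite ?inE//;
    exact: measurable_vball.
Qed.

End Borel.

(** * Haar measure on a lattice *)

Lemma eq_probability_on (d : measure_display) (T : measurableType d)
    (R : realType) (P : probability T R) (A B C : set T) :
  measurable A -> measurable B -> measurable C -> P A = 1%E ->
  (forall x, A x -> B x <-> C x) -> P B = P C.
Proof.
move=> mA mB mC PA BC.
have PCA : P (~` A) = 0%E by rewrite probability_setC// PA subee.
have h D : measurable D -> P D = P (D `&` A).
  move=> mD; rewrite (measureDI P mD mA) [X in (X + _)%E](_ : _ = 0%E) ?add0e//.
  have mAC := measurableC mA; have mDA := measurableD mD mA.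
  by apply: (@subset_measure0 _ _ _ P _ (~` A)) => // x [].
rewrite h// [RHS]h//; congr (P _); apply/seteqP.
by split=> x [h1 h2]; split=> //; apply/(BC x h2).
Qed.

(** Greedy choice: an element is kept only if [e] relates it to none of those already kept. *)
Lemma pairwise_representatives (T : eqType) (e : rel T) (s : seq T) :
  reflexive e -> exists2 r, {subset r <= s} &
    pairwise (fun x y => ~~ e x y) r /\ forall x, x \in s -> has (e x) r.
Proof.
move=> e_refl; elim: s => [|x s [r sub [pr hr]]]; first by exists [::].
have [hx|hx] := boolP (has (e x) r).
  exists r; first by move=> y /sub; rewrite inE orbC => ->.
  by split=> // y; rewrite inE => /predU1P[->|/hr].
exists (x :: r).
  by move=> y; rewrite !inE => /predU1P[->|/sub ->]; rewrite ?eqxx ?orbT.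
split; first by rewrite /= pr andbT all_predC.
by move=> y; rewrite inE => /predU1P[->|/hr hy] /=; rewrite ?e_refl ?hy ?orbT.
Qed.

Section Lattice.
Variables (K : topologicalFieldType) (v : K -> \bar int).
Hypothesis hv : discrete_valuation v.
Variables (d : nat) (L : set 'cV[K]_d).
Hypothesis latL : lattice v L.

Lemma lattice_closed : closed L.
Proof.
by have [cL _ _ _] := latL; apply: compact_closed cL; exact: hausdorff_mx hv d.
Qed.

Lemma latticeN x : L x -> L (- x).
Proof.
have [_ _ _ LZ] := latL => Lx; rewrite -scaleN1r; apply: LZ => //.
by rewrite /valuation_ring /= (valN hv) (val1 hv).
Qed.

Lemma latticeB x y : L x -> L y -> L (x - y).
Proof. by have [_ _ LD _] := latL => Lx Ly; apply: LD => //; exact: latticeN. Qed.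

Definition fibre0 (I : {set 'I_d}) : set 'cV[K]_d :=
  [set z | L z /\ forall i, i \in I -> z i 0 = 0].

Lemma fibre0_lattice I : lattice v (fibre0 I).
Proof.
have [cL L0 LD LZ] := latL; split.
- have -> : fibre0 I = L `&` [set z | forall i, i \in I -> z i 0 = 0] by [].
  apply: compact_closedI => // z cz i iI; apply: (vge_eq0 hv) => n.
  have [|y [hy hyz]] := cz [set y | forall i, vge v n%:Z (y i 0 - z i 0)].
    by apply/(nbhs_vge_mx hv); exists n.
  by have := hyz i; rewrite hy// sub0r (vgeN hv).
- by split=> // i _; rewrite mxE.
- by move=> x y [Lx hx] [Ly hy]; split=> [|i iI]; [exact: LD|rewrite mxE hx ?hy ?addr0].
- by move=> a x ha [Lx hx]; split=> [|i iI]; [exact: LZ|rewrite mxE hx ?mulr0].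
Qed.

(** [s] represents exactly once each class modulo pi^n O of the projection of [L] to the [j]-th
    coordinate. For the fibre L0, its size is the index N of the overview. *)
Lemma lattice_representatives (j : 'I_d) (n : int) : exists s : seq K,
  [/\ pairwise (fun x y => ~~ vge v n (x - y)) s,
      forall h, h \in s -> exists2 y, L y & y j 0 = h
    & forall y, L y -> has (fun h => vge v n (y j 0 - h)) s].
Proof.
have [cL _ _ _] := latL; have [s0 s0L hs0] := compact_net_mx hv n cL.
have [|s sub [ps hs]] := @pairwise_representatives K
    (fun x y => vge v n (x - y)) [seq x j 0 | x : 'cV[K]_d <- s0].
  by move=> x; rewrite subrr (vge0 hv).
exists s; split=> // [h /sub /mapP[x xs ->]|y Ly].
  by exists x => //; exact: s0L.
have [x xs hx] := hs0 y Ly.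
have /hs /hasP[h hs' xh] : x j 0 \in [seq x j 0 | x : 'cV[K]_d <- s0].
  by apply/mapP; exists x.
by apply/hasP; exists h => //; apply: (vge_trans hv (hx j)).
Qed.

(** Changing a coordinate by an element of pi^n O does not affect membership, so a point of the
    closure already belongs to the set. *)
Lemma closed_has_vge (j : 'I_d) (a : K) n (s : seq K) :
  closed [set z : 'cV[K]_d | has (fun h => vge v n (z j 0 - a - h)) s].
Proof.
move=> z cz /=; have [|y [hy hyz]] := cz [set y | forall i, vge v n (y i 0 - z i 0)].
  have := @open_vball_mx K v hv d z n; rewrite openE => /(_ z); apply => i /=.
  by rewrite subrr (vge0 hv).
have /hasP[h hs yh] := hy; apply/hasP; exists h => //.
have := vgeB hv yh (hyz j); congr (is_true (vge v n _)); ring.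
Qed.

End Lattice.

(** * Translation invariance of the law of a Gaussian vector *)

Section GaussianVector.
Variables (K : topologicalFieldType) (v : K -> \bar int).
Hypothesis hv : discrete_valuation v.
Variables (d : nat) (L : set 'cV[K]_d).
Hypothesis latL : lattice v L.
Context (R : realType) (disp : measure_display) (Omega : measurableType disp)
  (P : probability Omega R).
Variable X : {RV P >-> borel 'cV[K]_d}.
Hypothesis haarX : normalized_haar L (distribution P X).

Lemma measurable_law (E : set 'cV[K]_d) :
  measurable (E : set (borel 'cV[K]_d)) -> measurable (X @^-1` E).
Proof. by move=> mE; rewrite -[X in measurable X]setTI; exact: (measurable_funP X). Qed.

Lemma measurable_lattice : measurable (L : set (borel 'cV[K]_d)).
Proof. by apply: closed_borel; exact: (lattice_closed hv latL). Qed.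

Lemma law_lattice : P (X @^-1` L) = 1%E.
Proof. by have [] := haarX. Qed.

Lemma eq_law (E F : set 'cV[K]_d) :
  measurable (E : set (borel 'cV[K]_d)) -> measurable (F : set (borel 'cV[K]_d)) ->
  (forall z, L z -> E z <-> F z) -> P (X @^-1` E) = P (X @^-1` F).
Proof.
move=> mE mF EF; apply: (eq_probability_on _ _ _ law_lattice).
- by apply: measurable_law; exact: measurable_lattice.
- exact: measurable_law.
- exact: measurable_law.
- by move=> w; exact: EF.
Qed.

Lemma measurable_translate (E : set 'cV[K]_d) (y : 'cV[K]_d) :
  measurable (E : set (borel 'cV[K]_d)) ->
  measurable ([set z | E (z + y)] : set (borel 'cV[K]_d)).
Proof.
move=> mE.
have := continuous_borel (@translation_continuous K v hv d y) measurableT mE.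
by rewrite setTI.
Qed.

(** [normalized_haar] gives invariance only for Borel subsets of [L]. So [E] is first cut down to
    [L], which carries the law and is stable under translation by [y]. *)
Lemma law_translate (E : set 'cV[K]_d) (y : 'cV[K]_d) : L y ->
  measurable (E : set (borel 'cV[K]_d)) ->
  P (X @^-1` [set z | E (z + y)]) = P (X @^-1` E).
Proof.
move=> Ly mE; have [_ inv] := haarX.
have mEL : measurable (E `&` L : set (borel 'cV[K]_d)).
  exact: measurableI mE measurable_lattice.
have [_ _ LD _] := latL.
transitivity (P (X @^-1` (E `&` L))); last first.
  by apply: eq_law => // z Lz; split=> [[]//|Ez]; split.
transitivity (distribution P X [set - y + x | x in E `&` L]); last first.
  by apply: inv => //; exact: (latticeN hv latL Ly).
have -> : [set - y + x | x in E `&` L] = [set z | (E `&` L) (z + y)].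
  apply/seteqP; split=> [_ [x ELx <-] /=|z /= ELz].
    by rewrite addrAC addNr add0r.
  by exists (z + y) => //; rewrite addrCA addNr addr0.
apply: eq_law; [exact: measurable_translate|exact: measurable_translate|].
move=> z Lz /=; split=> [Ezy|[]//]; split=> //; exact: LD.
Qed.

Lemma measurable_coord_preimage (j : 'I_d) (B : set (borel K)) : measurable B ->
  measurable ([set z | B (z j 0)] : set (borel 'cV[K]_d)).
Proof.
move=> mB; have := continuous_borel (@coord_continuous_mx K v hv d j) measurableT mB.
by rewrite setTI.
Qed.

(* The cosets [a + h + pi^n O] for [h] in [s] are permuted transitively by
   translations that preserve both [T] and the law, so they are equally likely. *)
Lemma law_cosets (T : set 'cV[K]_d) (j : 'I_d) (a : K) (n : int) (s : seq K) :
  measurable (T : set (borel 'cV[K]_d)) ->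
  pairwise (fun x y => ~~ vge v n (x - y)) s ->
  (forall h, h \in s -> exists2 y, L y & y j 0 = h /\ forall z, T (z + y) <-> T z) ->
  P (X @^-1` [set z | T z /\ has (fun h => vge v n (z j 0 - a - h)) s]) =
  ((size s)%:R%:E * P (X @^-1` [set z | T z /\ vge v n (z j 0 - a)%R]))%E.
Proof.
move=> mT.
have mball b : measurable ([set z | vge v n (z j 0 - b)] : set (borel 'cV[K]_d)).
  exact: (measurable_coord_preimage j (measurable_vball hv b n)).
have mTb b : measurable ([set z | T z /\ vge v n (z j 0 - b)] : set (borel 'cV[K]_d)).
  exact: (measurableI _ _ mT (mball b)).
have mhas r : measurable ([set z | T z /\ has (fun h => vge v n (z j 0 - a - h)) r]
    : set (borel 'cV[K]_d)).
  apply: (measurableI _ _ mT); apply: closed_borel; exact: (closed_has_vge hv).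
elim: s => [_ _|h s IH /= /andP[hs ps] hT].
  rewrite mul0e (_ : X @^-1` _ = set0) ?measure0//.
  by apply/seteqP; split=> w //= [].
have {}IH := IH ps (fun h' h's => hT h' (mem_behead (s := h :: s) h's)).
have [y Ly [yh Ty]] := hT h (mem_head _ _).
have -> : X @^-1` [set z | T z /\ vge v n (z j 0 - a - h) ||
            has (fun h => vge v n (z j 0 - a - h)) s] =
    X @^-1` [set z | T z /\ vge v n (z j 0 - (a + h))] `|`
    X @^-1` [set z | T z /\ has (fun h => vge v n (z j 0 - a - h)) s].
  apply/seteqP; split=> w /=.
    by move=> [Tw /orP[]]; rewrite opprD addrA; [left|right].
  by rewrite opprD addrA => -[[Tw hw]|[Tw hw]]; split=> //; apply/orP; [left|right].
rewrite measureU; last 1 first.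
- apply/seteqP; split=> w //= -[[_ w1] [_ /hasP[h' h's w2]]].
  move/allP: hs => /(_ h' h's) /negP; apply; rewrite (vge_sym hv).
  by have := vgeB hv w1 w2; congr (is_true (vge v n _)); ring.
(* Translation by [y] turns the ball around a + h into the ball around a and preserves [T], so the
   new coset contributes one more copy of the same probability. *)
- rewrite [X in (_ + X)%E]IH -[X in (X + _)%E](law_translate Ly); last exact: mTb.
  rewrite -natr1 EFinD muleDl//; last first.
    by rewrite fin_num_measure//; apply: measurable_law; rewrite -[a]addr0; exact: mTb.
  rewrite -[1%:E]/1%E mul1e addeC; congr (_ * _ + P _)%E.
  apply/seteqP; split=> w /= [Tw]; rewrite mxE yh => hw; split.
  + exact/Ty.
  + by move: hw; congr (is_true (vge v n _)); ring.
  + exact/Ty.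
  + by move: hw; congr (is_true (vge v n _)); ring.
- by apply: measurable_law; exact: mTb.
- by apply: measurable_law; exact: mhas.
Qed.

End GaussianVector.

(** * The conditional law of one coordinate given X_I *)

Section ConditionalLaw.
Variables (K : topologicalFieldType) (v : K -> \bar int).
Hypothesis hv : discrete_valuation v.
Variables (d : nat) (L : set 'cV[K]_d).
Hypothesis latL : lattice v L.
Context (R : realType) (disp : measure_display) (Omega : measurableType disp)
  (P : probability Omega R).
Variable X : {RV P >-> borel 'cV[K]_d}.
Hypothesis haarX : normalized_haar L (distribution P X).
Variable I : {set 'I_d}.

Local Notation Y := (subvector X I).
Local Notation L0 := (fibre0 L I).

Lemma measurable_subvector : measurable_fun setT Y.
Proof.
have mr := continuous_borel (@restrict_col_continuous K v hv d I).
exact: (measurableT_comp mr (measurable_funP X)).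
Qed.

Lemma measurable_component j : measurable_fun setT (component X j).
Proof.
have mr := continuous_borel (@coord_continuous_mx K v hv d j).
exact: (measurableT_comp mr (measurable_funP X)).
Qed.

Lemma measurable_component_preimage j (B : set (borel K)) : measurable B ->
  measurable (component X j @^-1` B).
Proof.
by move=> mB; rewrite -[A in measurable A]setTI; exact: measurable_component.
Qed.

Lemma restrict_col_eq (x z : 'cV[K]_d) :
  restrict_col I x = restrict_col I z -> forall i, i \in I -> x i 0 = z i 0.
Proof.
move=> E i iI; have := congr1 (fun u : 'cV[K]_#|I| => u (enum_rank_in iI i) 0) E.
by rewrite !mxE enum_rankK_in.
Qed.

Lemma restrict_colD0 (z y : 'cV[K]_d) :
  (forall i, i \in I -> y i 0 = 0) -> restrict_col I (z + y) = restrict_col I z.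
Proof.
by move=> y0; apply/colP => k; rewrite !mxE y0 ?addr0// enum_valP.
Qed.

(* The event [X_j \in a + s + pi^n O], up to a null set, written so that it is
   visibly measurable with respect to [X_I]. *)
Definition coset_event j a n (s : seq K) : set Omega :=
  Y @^-1` (@restrict_col K d I @`
    (L `&` [set z : 'cV[K]_d | has (fun h => vge v n (z j 0 - a - h)) s])).

(** The continuous image of a compact set is compact, hence closed in a Hausdorff space, hence
    Borel. *)
Lemma coset_event_sigma j a n s :
  g_sigma_algebra_preimage Y (coset_event j a n s).
Proof.
exists (@restrict_col K d I @`
    (L `&` [set z : 'cV[K]_d | has (fun h => vge v n (z j 0 - a - h)) s])); last first.
  by rewrite setTI.
apply: closed_borel; apply: compact_closed; first exact: (hausdorff_mx hv).
apply: continuous_compact.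
  by apply: continuous_subspaceT; exact: (@restrict_col_continuous K v hv d I).
have [cL _ _ _] := latL.
by apply: compact_closedI => //; exact: (closed_has_vge hv).
Qed.

Section Representatives.
Variables (j : 'I_d) (n : int) (s : seq K).
Hypothesis ps : pairwise (fun x y => ~~ vge v n (x - y)) s.
Hypothesis sL0 : forall h, h \in s -> exists2 y, L0 y & y j 0 = h.
Hypothesis hs : forall y, L0 y -> has (fun h => vge v n (y j 0 - h)) s.

(** Two points of [L] with the same coordinates in [I] differ by an element of L0, and [s]
    represents the group of [j]-th coordinates of L0 modulo pi^n O. So, on [L], lying in a + s +
    pi^n O depends only on the coordinates in [I]. *)
Lemma coset_eventE a w : L (X w) ->
  coset_event j a n s w <-> has (fun h => vge v n (X w j 0 - a - h)) s.
Proof.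
move=> LX; split; last by move=> hX; exists (X w).
move=> [z [Lz /= /hasP[h h_s zh]] E].
have [y [Ly y0] yh] := sL0 h_s.
have [_ _ LD _] := latL.
have /hs /hasP[k k_s hk] : L0 (X w - z + y).
  split; first by apply: LD Ly; apply: (latticeB hv latL).
  by move=> i iI; rewrite !mxE (restrict_col_eq E iI) subrr add0r y0.
apply/hasP; exists k => //.
have := vgeD hv hk zh; rewrite !mxE yh; congr (is_true (vge v n _)); ring.
Qed.

Lemma size_representatives : (size s)%:R != 0 :> R.
Proof.
have [_ L00 _ _] := fibre0_lattice hv latL I.
by rewrite pnatr_eq0 size_eq0; apply: contraTneq (hs L00) => ->.
Qed.

(** Almost surely the event is a disjoint union of equally likely balls, counted by [law_cosets].
    The set [T] will carry the condition on X_I and on the coordinates already treated. *)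
Lemma law_coset_event (T : set 'cV[K]_d) a :
  measurable (T : set (borel 'cV[K]_d)) ->
  (forall h, h \in s -> exists2 y, L y & y j 0 = h /\ forall z, T (z + y) <-> T z) ->
  P (X @^-1` T `&` coset_event j a n s) =
  ((size s)%:R%:E *
   P (X @^-1` T `&` component X j @^-1` [set x | vge v n (x - a)%R]))%E.
Proof.
move=> mT hT; rewrite -(law_cosets hv latL haarX a mT ps hT).
apply: (eq_probability_on _ _ _ (law_lattice haarX)).
- by apply: measurable_law; exact: (measurable_lattice hv latL).
- apply: measurableI; first exact: measurable_law.
  apply: (measurable_preimage measurable_subvector); exact: coset_event_sigma.
- apply: measurable_law; apply: (measurableI _ _ mT).
  by apply: closed_borel; exact: (closed_has_vge hv).
by move=> w LX /=; split=> -[Tw hw]; split=> //; apply/coset_eventE.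
Qed.

(** Translations by L0 preserve every event determined by X_I, so each such event meets the coset
    event with [size s] times the probability with which it meets the ball. *)
Lemma ball_conditional_probability a :
  conditional_probability P Y (component X j @^-1` [set x | vge v n (x - a)])
    (fun w => (size s)%:R^-1 * \1_(coset_event j a n s) w).
Proof.
have sE := coset_event_sigma j a n s.
have mE := measurable_preimage measurable_subvector sE.
have N0 := size_representatives.
split.
- apply: measurable_funM; first exact: measurable_cst.
  exact: (@measurable_indic _ (g_sigma_algebra_preimageType Y)).
- rewrite (_ : EFin \o _ =
      (fun w => (size s)%:R^-1%:E * (\1_(coset_event j a n s) w)%:E)%E).
    by apply: integrableZl => //; exact: integrable_indic.
  by apply/funext => w /=; rewrite EFinM.
move=> C [D mD <-]; rewrite setTI.
have mC : measurable (Y @^-1` D).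
  by rewrite -[A in measurable A]setTI; exact: measurable_subvector.
under eq_integral do rewrite EFinM.
rewrite ge0_integralZl//; last first.
  by apply/measurable_EFinP/measurable_funTS; exact: measurable_indic.
rewrite integral_indic//.
have mT : measurable ([set z | D (restrict_col I z)] : set (borel 'cV[K]_d)).
  have := continuous_borel (@restrict_col_continuous K v hv d I) measurableT mD.
  by rewrite setTI.
have hT h : h \in s -> exists2 y, L y & y j 0 = h /\
    forall z, D (restrict_col I (z + y)) <-> D (restrict_col I z).
  move=> /sL0 [y [Ly y0] yh]; exists y => //; split=> // z.
  by rewrite restrict_colD0.
have E := law_coset_event a mT hT.
rewrite setIC [X in (_ * X)%E](_ : _ = (size s)%:R%:E *
  P (Y @^-1` D `&` component X j @^-1` [set x | vge v n (x - a)%R]))%E //.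
by rewrite muleA -EFinM mulVf// mul1e setIC.
Qed.

End Representatives.
End ConditionalLaw.

(** * Conditional independence of the coordinates *)

Section Independence.
Variables (K : topologicalFieldType) (v : K -> \bar int).
Hypothesis hv : discrete_valuation v.
Hypothesis hK : local_field K.
Variables (d : nat) (L : set 'cV[K]_d).
Hypothesis latL : lattice v L.
Context (R : realType) (disp : measure_display) (Omega : measurableType disp)
  (P : probability Omega R).
Variable X : {RV P >-> borel 'cV[K]_d}.
Hypothesis haarX : normalized_haar L (distribution P X).
Variable I : {set 'I_d}.

Local Notation Y := (subvector X I).
Local Notation L0 := (fibre0 L I).
Local Notation sY := (g_sigma_algebra_preimage Y).
Let mY : measurable_fun setT Y.
Proof. exact: (@measurable_subvector K v hv d R disp Omega P X I). Qed.

(** The product condition on the projection of L0 to K^J, in the form that supplies translations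
    moving a single coordinate of [J]. *)
Definition coordinates_split (J : {set 'I_d}) : Prop :=
  forall j y, j \in J -> L0 y ->
    exists2 y', L0 y' & y' j 0 = y j 0 /\ forall i, i \in J -> i != j -> y' i 0 = 0.

(* Induction on the list of coordinates: as functions of the Borel set of the new
   coordinate, both sides are finite measures, so it suffices to compare them on
   balls, where the conditional probability is explicit. *)
Lemma split_seq_independent (J : {set 'I_d}) (r : seq 'I_d)
    (B : 'I_d -> set (borel K)) (p : 'I_d -> Omega -> R) :
  coordinates_split J -> uniq r -> {subset r <= J} ->
  (forall j, j \in r -> measurable (B j)) ->
  (forall j, j \in r ->
     conditional_probability P Y (component X j @^-1` B j) (p j)) ->
  (forall j w, 0 <= p j w) ->
  forall C, sY C ->
    (\int[P]_(w in C) (\prod_(j <- r) p j w)%:E)%E =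
    P (C `&` \bigcap_(j in [set` r]) (component X j @^-1` B j)).
Proof.
move=> splitJ; elim: r B p => [|j r IH] B p /=.
  move=> _ _ _ _ _ C sC; rewrite (_ : \bigcap_(j in _) _ = setT) ?setIT.
    under eq_integral do rewrite big_nil.
    by rewrite integral_cst ?mul1e//; exact: (measurable_preimage mY).
  by apply/seteqP; split.
move=> /andP[jr ur] rJ mB cp p0 C sC.
have mBj : measurable (B j) by apply: mB; rewrite mem_head.
have rJ' : {subset r <= J} by move=> i ir; apply: rJ; rewrite inE ir orbT.
have mB' i : i \in r -> measurable (B i) by move=> ir; apply: mB; rewrite inE ir orbT.
have cp' i : i \in r -> conditional_probability P Y (component X i @^-1` B i) (p i).
  by move=> ir; apply: cp; rewrite inE ir orbT.
have {}IH := IH B p ur rJ' mB' cp' p0.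
have mC := measurable_preimage mY sC.
pose f w := \prod_(i <- r) p i w.
have f0 w : 0 <= f w by apply: prodr_ge0.
have sf : @measurable_fun _ _ (g_sigma_algebra_preimageType Y) _ setT f.
  by apply: measurable_prod => i /cp' [].
have mf := measurable_fun_preimage mY sf.
pose A := \bigcap_(i in [set` r]) (component X i @^-1` B i).
have mA : measurable A.
  apply: fin_bigcap_measurable; first exact: finite_seq.
  by move=> i /= ir; apply: (measurable_component_preimage hv); exact: mB'.
pose S : set 'cV[K]_d := \bigcap_(i in [set` r]) [set z : 'cV[K]_d | B i (z i 0)].
have mS : measurable (S : set (borel 'cV[K]_d)).
  apply: fin_bigcap_measurable; first exact: finite_seq.
  by move=> i /= ir; apply: (measurable_coord_preimage hv); exact: mB'.
have mXj : measurable_fun setT (component X j) by exact: (measurable_component hv X j).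
(* [m1] and [m2] are the two sides as measures in the Borel set of the [j]-th coordinate; [f] is the
   product of the remaining factors. *)
have [m1 m1E] : exists m : {measure set (borel K) -> \bar R}, forall D,
    m D = (\int[P]_(w in C `&` component X j @^-1` D) (f w)%:E)%E.
  by apply: pushforward_density => //; exact/measurable_EFinP.
have [m2 m2E] : exists m : {measure set (borel K) -> \bar R}, forall D,
    m D = (\int[P]_(w in (C `&` A) `&` component X j @^-1` D) (cst 1 w))%E.
  by apply: pushforward_density => //; exact: measurableI.
have mj D : measurable D -> measurable (component X j @^-1` D).
  exact: (measurable_component_preimage hv).
have {}m2E D : measurable D -> m2 D = P ((C `&` A) `&` component X j @^-1` D).
  move=> mD; rewrite m2E integral_cst ?mul1e//.
  by apply: measurableI; [exact: measurableI|exact: mj].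
transitivity (m1 (B j)).
  rewrite m1E -(integral_conditional_probability mY (mj _ mBj) sC _ (p0 j) sf f0).
    by apply: eq_integral => w _; rewrite big_cons -EFinM mulrC.
  by apply: cp; rewrite mem_head.
rewrite (_ : C `&` _ = (C `&` A) `&` component X j @^-1` B j); last first.
  rewrite -setIA; congr (_ `&` _); apply/seteqP; split=> w /= h.
    split; last by apply: (h j); rewrite /= mem_head.
    by move=> i /= ir; apply: (h i); rewrite /= inE ir orbT.
  by move=> i /=; rewrite inE => /predU1P[->|ir]; [exact: h.2|exact: h.1].
rewrite -m2E//; apply: (borel_measure_unique hv hK) => //; last first.
  rewrite m1E preimage_setT setIT IH//.
  by apply: le_lt_trans (probability_le1 P _) (ltry _); exact: measurableI.
move=> a n.
have mball := measurable_vball hv a n.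
have [s [ps sL0 hs]] := lattice_representatives hv (fibre0_lattice hv latL I) j n.
have cq := ball_conditional_probability hv latL haarX ps sL0 hs a.
have N0 : (size s)%:R != 0 :> R by exact: (size_representatives hv latL R hs).
have sE := coset_event_sigma hv latL X I j a n s.
have mE := measurable_preimage mY sE.
rewrite m2E// m1E.
rewrite -(integral_conditional_probability mY (mj _ mball) sC cq _ sf f0); last first.
  by move=> w; rewrite mulr_ge0// invr_ge0.
transitivity ((size s)%:R^-1%:E *
    \int[P]_(w in C `&` coset_event v L X I j a n s) (f w)%:E)%E.
  rewrite integral_mkcondr -ge0_integralZl//.
  - apply: eq_integral => w _; rewrite epatch_indic -!EFinM; congr EFin; ring.
  - apply: (measurable_restrict _ mE _).1 => //.
    exact/measurable_EFinP/measurable_funTS.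
  - by move=> w _; apply: erestrict_ge0 => w' _; rewrite lee_fin.
(* The coset event is determined by X_I, so the induction hypothesis applies to its intersection
   with [C]. *)
rewrite IH; last exact: (g_sigma_algebra_preimageI sC sE).
move: sC => [D mD]; rewrite setTI => CE.
have mT : measurable ([set z | D (restrict_col I z)] `&` S : set (borel 'cV[K]_d)).
  apply: (measurableI _ _ _ mS).
  have := continuous_borel (@restrict_col_continuous K v hv d I) measurableT mD.
  by rewrite setTI.
have CA : C `&` A = X @^-1` ([set z | D (restrict_col I z)] `&` S).
  by rewrite -CE.
have jJ : j \in J by apply: rJ; rewrite mem_head.
(* By [splitJ], the translation can be chosen to fix X_I and the coordinates in [r], hence to
   preserve both conditions, while moving the [j]-th coordinate by [h]. *)
have hT h : h \in s -> exists2 y, L y & y j 0 = h /\ forall z,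
    ([set z | D (restrict_col I z)] `&` S) (z + y) <->
    ([set z | D (restrict_col I z)] `&` S) z.
  move=> /sL0 [y Ly <-]; have [y' [Ly' y'I] [y'j y'J]] := splitJ j y jJ Ly.
  exists y' => //; split=> // z /=; rewrite restrict_colD0//.
  have e i : i \in r -> (z + y') i 0 = z i 0.
    move=> ir; rewrite mxE y'J ?addr0//; first exact: rJ'.
    by apply: contraNneq jr => <-.
  by split=> -[hD hS]; split=> // i /= ir; have := hS i ir; rewrite /= e.
have EQ := law_coset_event hv latL haarX ps sL0 hs a mT hT.
rewrite -/A (setIAC C _ A) CA [X in (_ * X)%E](_ : _ = (size s)%:R%:E * P (X @^-1`
   ([set z | D (restrict_col I z)] `&` S) `&`
   component X j @^-1` [set x | vge v n (x - a)%R]))%E //.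
by rewrite muleA -EFinM mulVf// mul1e.
Qed.

(** The given versions may be negative on null sets. They are replaced by the nonnegative [q], for
    which the integrals are known, and the two products agree almost everywhere. *)
Lemma split_independent (J : {set 'I_d}) :
  coordinates_split J -> independent_given P X I J.
Proof.
move=> splitJ B p mB cp.
have mA j : j \in J -> measurable (component X j @^-1` B j).
  by move=> jJ; apply: (measurable_component_preimage hv); exact: mB.
pose q j w := Num.max (p j w) 0.
have cq j : j \in J -> conditional_probability P Y (component X j @^-1` B j) (q j).
  by move=> jJ; apply: (conditional_probability_max0 mY (mA j jJ)); exact: cp.
have key C : sY C -> (\int[P]_(w in C) (\prod_(j in J) q j w)%:E)%E =
    P (C `&` \bigcap_(j in [set` J]) (component X j @^-1` B j)).
  move=> sC; under eq_integral do rewrite -big_enum.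
  rewrite (@split_seq_independent J (enum J) B q)//.
  - congr (P (_ `&` _)); apply/seteqP; split=> w h j /= jJ; apply: h => /=.
      by rewrite mem_enum.
    by rewrite mem_enum in jJ.
  - exact: enum_uniq.
  - by move=> j; rewrite mem_enum.
  - by move=> j; rewrite mem_enum; exact: mB.
  - by move=> j; rewrite mem_enum; exact: cq.
  - by move=> j w; rewrite /q le_max lexx orbT.
have mprod (g : 'I_d -> Omega -> R) :
    (forall j, j \in J ->
       conditional_probability P Y (component X j @^-1` B j) (g j)) ->
    @measurable_fun _ _ (g_sigma_algebra_preimageType Y) _ setT
      (fun w => \prod_(j in J) g j w).
  move=> cg; under eq_fun do rewrite -big_enum.
  by apply: measurable_prod => j; rewrite mem_enum => /cg [].
have mp := measurable_fun_preimage mY (mprod p cp).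
have mq := measurable_fun_preimage mY (mprod q cq).
have ae (D : set Omega) : ae_eq P D (EFin \o (fun w => \prod_(j in J) p j w))
                          (EFin \o (fun w => \prod_(j in J) q j w)).
  have [N [mN PN sub]] : {ae P, forall w, forall j, j \in J -> p j w = q j w}.
    apply: filter_forall => j; have [jJ|jJ] := boolP (j \in J); last first.
      by apply: aeW.
    have [N [mN PN sub]] := conditional_probability_ae_ge0 mY (mA j jJ) (cp j jJ).
    exists N; split=> // w /= /not_implyP[_ hw]; apply: sub => /=.
    by rewrite ltNge; apply/negP => p0'; apply: hw; rewrite /q max_l.
  exists N; split=> // w /= /not_implyP[_ hw]; apply: sub => /= hpq; apply: hw.
  by congr EFin; apply: eq_bigr.
have q0 w : 0 <= \prod_(j in J) q j w.
  by apply: prodr_ge0 => j _; rewrite /q le_max lexx orbT.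
split; first exact: mprod.
- apply/integrableP; split; first exact/measurable_EFinP.
  rewrite (_ : (\int[P]_x _)%E = (\int[P]_w (\prod_(j in J) q j w)%:E)%E).
    rewrite key; last exact: (@measurableT _ (g_sigma_algebra_preimageType Y)).
    rewrite setTI; apply: le_lt_trans (probability_le1 P _) (ltry _).
    by apply: fin_bigcap_measurable => //; exact: finite_finset.
  have [N [mN PN sub]] := ae setT.
  apply: ae_eq_integral => //.
  + by apply: measurableT_comp => //; exact/measurable_EFinP.
  + exact/measurable_EFinP.
  exists N; split=> // w /= /not_implyP[_ hw]; apply: sub => /= /(_ Logic.I) [hpq].
  by apply: hw; rewrite hpq ger0_norm.
move=> C sC; have mC := measurable_preimage mY sC.
rewrite setIC -key//; apply: ae_eq_integral => //.
- by apply/measurable_funTS/measurable_EFinP.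
- by apply/measurable_funTS/measurable_EFinP.
- exact: ae.
Qed.

(** Finitely many translates of the ball by points of [L] cover [L], and all have the same
    probability. If it were 0, then [L] would be a null set. *)
Lemma law_vball_gt0 (n : int) :
  (0 < P (X @^-1` (L `&` [set z : 'cV[K]_d | forall i, vge v n (z i 0)%R])))%E.
Proof.
pose V (x : 'cV[K]_d) : set 'cV[K]_d :=
  [set z : 'cV[K]_d | forall i, vge v n (z i 0 - x i 0)].
have mV x : measurable (V x : set (borel 'cV[K]_d)).
  by apply: sub_sigma_algebra; exact: (open_vball_mx hv).
have mL := measurable_lattice hv latL.
have -> : P (X @^-1` (L `&` [set z : 'cV[K]_d | forall i, vge v n (z i 0)])) =
          P (X @^-1` (V 0)).
  rewrite (_ : [set z : 'cV[K]_d | _] = V 0); last exact: vball0_mx.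
  apply: (eq_law hv latL haarX) => //; first exact: (measurableI _ _ mL (mV 0)).
  by move=> z Lz; split=> [[]//|Vz]; split.
rewrite lt0e measure_ge0 andbT; apply/negP => /eqP V0.
have [cL _ _ _] := latL; have [s sL cov] := compact_net_mx hv n cL.
have {}V0 x : L x -> P (X @^-1` V x) = 0%E.
  move=> Lx; rewrite -V0 -(law_translate hv latL haarX (latticeN hv latL Lx) (mV 0)).
  by congr (P _); apply/seteqP; split=> w h i; have := h i; rewrite !mxE subr0.
have : P.-negligible (\big[setU/set0]_(x <- s) (X @^-1` V x)).
  elim: s {cov} sL => [|x s IH] sL; first by rewrite big_nil; exact: negligible_set0.
  rewrite big_cons; apply: negligibleU.
    exists (X @^-1` V x); split=> //; first exact: measurable_law.
    by apply: V0; apply: sL; rewrite mem_head.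
  by apply: IH => y ys; apply: sL; rewrite inE ys orbT.
move=> [N [mN PN sub]].
have : P (X @^-1` L) = 0%E.
  apply: (@subset_measure0 _ _ _ P _ N) => //; first exact: measurable_law.
  move=> w /cov [x xs hx]; apply: sub; rewrite -bigcup_seq; by exists x.
by rewrite (law_lattice haarX) => /eqP; rewrite onee_eq0.
Qed.

(** Without such a point, the event that X_I is near 0 and each X_j is near its target would be
    null. Independence expresses its probability as the integral of a product of explicit versions,
    which equals a positive constant on the event that X lies in [L] and is near 0, and that event
    has positive probability. *)
Lemma independent_approx (J : {set 'I_d}) (h : 'I_d -> 'cV[K]_d) (n : nat) :
  independent_given P X I J -> (forall j, j \in J -> L0 (h j)) ->
  exists2 z, L z & (forall i, i \in I -> vge v n%:Z (z i 0)) /\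
                   (forall j, j \in J -> vge v n%:Z (z j 0 - h j j 0)).
Proof.
move=> ind hL0; apply: contrapT => nex.
have /choice [s hs] := fun j =>
  lattice_representatives hv (fibre0_lattice hv latL I) j n%:Z.
pose B j : set (borel K) := [set x | vge v n%:Z (x - h j j 0)].
pose q j w : R :=
  (size (s j))%:R^-1 * \1_(coset_event v L X I j (h j j 0) n%:Z (s j)) w.
have [mq iq eq] : conditional_probability P Y
    (\bigcap_(j in [set` J]) (component X j @^-1` B j)) (fun w => \prod_(j in J) q j w).
  apply: ind => j jJ; first exact: (measurable_vball hv).
  have [ps sL0 hs'] := hs j.
  exact: (ball_conditional_probability hv latL haarX ps sL0 hs').
have mq' := measurable_fun_preimage mY mq.
pose D : set 'cV[K]_#|I| := [set z | forall i, vge v n%:Z (z i 0)].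
have mD : measurable (D : set (borel 'cV[K]_#|I|)).
  by apply: sub_sigma_algebra; exact: (open_vball0_mx hv).
have sC : sY (Y @^-1` D) by exists D => //; rewrite setTI.
have mC := measurable_preimage mY sC.
have E0 : P ((\bigcap_(j in [set` J]) (component X j @^-1` B j)) `&` (Y @^-1` D)) = 0%E.
  rewrite -(measure0 P); apply: (eq_probability_on _ _ _ (law_lattice haarX)) => //.
  - by apply: measurable_law; exact: (measurable_lattice hv latL).
  - apply: measurableI => //; apply: fin_bigcap_measurable => [|j _].
      exact: finite_finset.
    by apply: (measurable_component_preimage hv); exact: (measurable_vball hv).
  move=> w LX; split=> // -[/= hB hD]; apply: nex; exists (X w) => //; split.
    move=> i iI; have := hD (enum_rank_in iI i).
    by rewrite !mxE enum_rankK_in.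
  by move=> j jJ; exact: hB.
have := eq _ sC; rewrite E0; apply/eqP; rewrite gt_eqF//.
pose V := X @^-1` (L `&` [set z : 'cV[K]_d | forall i, vge v n%:Z (z i 0)]).
have mV : measurable V.
  apply: measurable_law; apply: (measurableI _ _ (measurable_lattice hv latL)).
  by apply: sub_sigma_algebra; exact: (open_vball0_mx hv).
have c0 : 0 < \prod_(j in J) (size (s j))%:R^-1 :> R.
  apply: prodr_gt0 => j _; have [_ _ hs'] := hs j.
  by rewrite invr_gt0 lt0r ler0n andbT; exact: (size_representatives hv latL R hs').
apply: (@lt_le_trans _ _ ((\prod_(j in J) (size (s j))%:R^-1)%:E * P V)%E).
  by rewrite mule_gt0//; exact: law_vball_gt0.
rewrite -integral_cst//.
apply: (@le_trans _ _ (\int[P]_(w in V) (\prod_(j in J) q j w)%:E)%E).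
  rewrite le_eqVlt; apply/orP; left; apply/eqP.
  apply: eq_integral => w; rewrite inE => -[LX hX] /=; congr EFin.
  apply: eq_bigr => j jJ; rewrite /q indicE mem_set ?mulr1//.
  have [ps sL0 hs'] := hs j.
  apply/(coset_eventE hv latL sL0 hs' _ LX).
  (* Since X_j is in pi^n O, the difference of X_j and its target is congruent to the [j]-th
     coordinate of [- h j], which has a representative in [s j]. *)
  have /hs' /hasP[k ks hk] : L0 (- h j).
    exact: (latticeN hv (fibre0_lattice hv latL I)) (hL0 j jJ).
  apply/hasP; exists k => //; have := vgeD hv (hX j) hk; rewrite mxE.
  by rewrite addrA.
apply: ge0_subset_integral => //.
- by apply/measurable_EFinP/measurable_funTS.
- move=> w _; rewrite lee_fin prodr_ge0// => j _.
  by rewrite mulr_ge0// invr_ge0.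
by move=> w [_ hX] i; rewrite mxE; exact: hX.
Qed.

End Independence.

(** * The residue field *)

Section ResidueField.
Variables (K : topologicalFieldType) (v : K -> \bar int).
Hypothesis hv : discrete_valuation v.

Lemma vge0V x : vge v 0 x -> ~~ vge v 1 x -> vge v 0 x^-1.
Proof.
move=> x0 x1; have xN0 : x != 0 by apply: contraNneq x1 => ->; exact: vge0.
have [m Em] := val_fin hv xN0.
have E0 : v x = 0%E.
  move: x0 x1; rewrite /vge Em !lee_fin -ltNge => m0.
  rewrite -[1]add0r ltzD1 => m1; congr EFin; apply/eqP; by rewrite eq_le m1 m0.
by rewrite -(vge_unscale hv 0 x^-1 E0) divff// /vge (val1 hv) addr0.
Qed.

(** [is_module] provides only a bijection of sets between the residue classes and ['I_q]. Choosing
    representatives makes it usable for transporting the ring operations. *)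
Lemma residue_code (q : nat) : is_module v q ->
  exists (code : K -> 'I_q) (rep : 'I_q -> K),
    [/\ forall k, vge v 0 (rep k), forall k, code (rep k) = k
      & forall x y, vge v 0 x -> vge v 0 y -> code x = code y <-> vge v 1 (x - y)].
Proof.
move=> [pi vpi /card_set_bijP[f [funf injf surjf]]].
pose cl x : set K := [set x + y | y in uniformizer_ideal v pi].
have idealE y : uniformizer_ideal v pi y <-> vge v 1 y.
  split=> [[z hz <-]|hy].
    by rewrite -[1]addr0 (vge_unscale hv _ _ vpi).
  have pi0 : pi != 0.
    by apply/eqP => pi0; move: vpi; rewrite pi0 (valuation_eqy hv 0).2.
  exists (pi^-1 * y); last by rewrite mulrA divff// mul1r.
  by rewrite /valuation_ring /= -/(vge v 0 _) -(vge_unscale hv _ _ vpi) mulrA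
    divff// mul1r addr0.
have clE x y : cl x = cl y <-> vge v 1 (x - y).
  split=> [E|xy].
    have : cl x x by exists 0; rewrite ?addr0//; apply/idealE; exact: vge0.
    by rewrite E => -[z /idealE hz <-]; rewrite addrAC subrr add0r.
  apply/seteqP; split=> _ [z /idealE hz <-].
    exists (x - y + z); last by ring.
    by apply/idealE; exact: vgeD.
  exists (y - x + z); last by ring.
  by apply/idealE; apply: (vgeD hv) => //; rewrite (vge_sym hv).
have fq x : vge v 0 x -> (f (cl x) < q)%N by move=> hx; apply: funf; exists x.
have q0 : (0 < q)%N by apply: leq_ltn_trans (fq 0 (vge0 hv 0)).
(* Outside the valuation ring, [code] takes the default value 0. *)
have /choice [code codeE] : forall x, exists k : 'I_q, vge v 0 x -> f (cl x) = k.
  move=> x; have [hx|hx] := boolP (vge v 0 x); last by exists (Ordinal q0).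
  by exists (Ordinal (fq x hx)).
have /choice [rep repE] : forall k : 'I_q, exists x, vge v 0 x /\ f (cl x) = k.
  move=> k; have [_ [x hx <-] fx] := surjf k (ltn_ord k).
  by exists x.
exists code, rep; split=> [k|k|x y hx hy]; first exact: (repE k).1.
  by apply/val_inj; rewrite /= -codeE ?(repE k).2//; exact: (repE k).1.
rewrite -clE; split=> [/(congr1 val)|E]; last first.
  by apply/val_inj; rewrite /= -!codeE// E.
by rewrite /= -!codeE//; apply: injf; rewrite inE; [exists x|exists y].
Qed.

(** The field is built on ['I_q]: operate on representatives in O and take the code of the result.
    Since codes are equal exactly for congruent elements, the laws descend from K. *)
Lemma residue_field (q : nat) : is_module v q ->
  exists (F : finFieldType) (red : K -> F),
  [/\ #|F| = q,
      forall c, exists2 x, vge v 0 x & red x = c,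
      forall x y, vge v 0 x -> vge v 0 y -> red (x + y) = red x + red y,
      forall x y, vge v 0 x -> vge v 0 y -> red (x * y) = red x * red y
    & forall x, vge v 0 x -> red x = 0 <-> vge v 1 x].
Proof.
move=> /residue_code [code [rep [rep0 repK codeE]]].
have O0 : vge v 0 0 by exact: vge0.
have O1 : vge v 0 1 by rewrite /vge (val1 hv).
have OD x y : vge v 0 x -> vge v 0 y -> vge v 0 (x + y) by exact: vgeD.
have OM x y : vge v 0 x -> vge v 0 y -> vge v 0 (x * y).
  by move=> hx hy; have := vgeM hv hx hy; rewrite addr0.
have ON x : vge v 0 (- x) = vge v 0 x by exact: vgeN.
have repE x : vge v 0 x -> vge v 1 (rep (code x) - x).
  by move=> hx; apply/codeE.
have M1 x y : vge v 0 x -> vge v 1 y -> vge v 1 (x * y).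
  by move=> hx hy; have := vgeM hv hx hy; rewrite add0r.
pose add i j := code (rep i + rep j).
pose mul i j := code (rep i * rep j).
pose opp i := code (- rep i).
(* The zero class is its own inverse, as the field structure demands; any other representative is a
   unit of O by [vge0V]. *)
pose inv i := if i == code 0 then code 0 else code (rep i)^-1.
have codeD x y : vge v 0 x -> vge v 0 y -> add (code x) (code y) = code (x + y).
  move=> hx hy; apply/codeE; [exact: OD|exact: OD|].
  have := vgeD hv (repE x hx) (repE y hy); congr (is_true (vge v 1 _)); ring.
have codeM x y : vge v 0 x -> vge v 0 y -> mul (code x) (code y) = code (x * y).
  move=> hx hy; apply/codeE; [exact: OM|exact: OM|].
  have := vgeD hv (M1 _ _ (rep0 (code y)) (repE x hx)) (M1 _ _ hx (repE y hy)).
  congr (is_true (vge v 1 _)); ring.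
have codeP i : exists2 x, vge v 0 x & i = code x by exists (rep i).
have addA : associative add.
  move=> i j k; have [x hx ->] := codeP i; have [y hy ->] := codeP j.
  by have [z hz ->] := codeP k; rewrite !codeD ?OD// addrA.
have addC : commutative add by move=> i j; rewrite /add addrC.
have add0 : left_id (code 0) add.
  by move=> i; have [x hx ->] := codeP i; rewrite codeD// add0r.
have addN : left_inverse (code 0) opp add.
  move=> i; rewrite -[i in X in add _ X]repK codeD ?ON// addNr //.
have mulA : associative mul.
  move=> i j k; have [x hx ->] := codeP i; have [y hy ->] := codeP j.
  by have [z hz ->] := codeP k; rewrite !codeM ?OM// mulrA.
have mulC : commutative mul by move=> i j; rewrite /mul mulrC.
have mul1 : left_id (code 1) mul.
  by move=> i; have [x hx ->] := codeP i; rewrite codeM// mul1r.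
have mulDl : left_distributive mul add.
  move=> i j k; have [x hx ->] := codeP i; have [y hy ->] := codeP j.
  by have [z hz ->] := codeP k; rewrite !(codeM, codeD) ?OD ?OM// mulrDl.
have one_neq0 : code 1 != code 0.
  apply/eqP => /codeE => /(_ O1 O0); rewrite subr0 /vge (val1 hv).
  by rewrite lee_fin.
have mulV i : i != code 0 -> mul (inv i) i = code 1.
  move=> i0; have n1 : ~~ vge v 1 (rep i).
    apply: contra i0 => r1; apply/eqP; rewrite -[i]repK; apply/codeE => //.
    by rewrite subr0.
  rewrite /inv (negbTE i0) -[i in X in mul _ X]repK codeM//; last exact: vge0V.
  rewrite mulVf//; apply: contraNneq n1 => ->; exact: vge0.
have inv0 : inv (code 0) = code 0 by rewrite /inv eqxx.
pose zm := GRing.isZmodule.Build 'I_q addA addC add0 addN.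
pose Z : zmodType := HB.pack 'I_q zm.
pose cm := GRing.Zmodule_isComNzRing.Build Z mulA mulC mul1 mulDl one_neq0.
pose C : comNzRingType := HB.pack 'I_q zm cm.
pose fm := GRing.ComNzRing_isField.Build C mulV inv0.
pose F : finFieldType := HB.pack 'I_q zm cm fm.
exists F, code; split=> //.
- exact: card_ord.
- by move=> c; exists (rep c).
- by move=> x y hx hy; rewrite -codeD.
- by move=> x y hx hy; rewrite -codeM.
- by move=> x hx; rewrite -[x in X in _ <-> X]subr0; apply: codeE.
Qed.

End ResidueField.

(** * Vector matroids *)

Local Close Scope classical_set_scope.

Section VectorMatroid.
Variables (T : finType) (F : fieldType) (V : vectType F) (u : T -> V).

Lemma perm_image_setD (A B : {set T}) : A \subset B ->
  perm_eq [seq u i | i in B] ([seq u i | i in A] ++ [seq u i | i in B :\: A]).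
Proof.
move=> AB; rewrite -map_cat; apply: perm_map; apply: uniq_perm.
- exact: enum_uniq.
- rewrite cat_uniq !enum_uniq andbT; apply/hasPn => x.
  by rewrite !mem_enum inE => /andP[].
- move=> x; rewrite mem_cat !mem_enum inE.
  by case: (boolP (x \in A)) => [/(fintype.subsetP AB) ->|].
Qed.

Lemma free_subset (A B : {set T}) : A \subset B ->
  free [seq u i | i in B] -> free [seq u i | i in A].
Proof. by move=> AB; rewrite (perm_free (perm_image_setD AB)); exact: catl_free. Qed.

(** If no element of [B] can be added to [A], the span of [B] lies in that of [A], and comparing
    dimensions bounds the size of [B] by that of [A]. *)
Lemma free_augment (A B : {set T}) :
  free [seq u i | i in A] -> free [seq u i | i in B] -> (#|A| < #|B|)%N ->
  exists2 x, x \in B :\: A & free [seq u i | i in x |: A]%SET.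
Proof.
move=> fA fB; apply: contraPP => /forall2NP nex; apply/negP; rewrite -leqNgt.
have sub : (<<[seq u i | i in B]>> <= <<[seq u i | i in A]>>)%VS.
  apply/span_subvP => _ /mapP[x + ->]; rewrite mem_enum => xB.
  have [xA|xA] := boolP (x \in A).
    by apply: memv_span; apply/mapP; exists x; rewrite ?mem_enum.
  have := nex x; rewrite inE xA xB => -[//|]; apply: contra_notT => xspan.
  rewrite (@perm_free _ _ _ (u x :: [seq u i | i in A])); last first.
    rewrite -[u x :: _]/(map u (x :: enum A)); apply: perm_map; apply: uniq_perm.
    - exact: enum_uniq.
    - by rewrite /= mem_enum xA enum_uniq.
    - by move=> y; rewrite inE !mem_enum !inE.
  by rewrite free_cons xspan.
have := dimvS sub; move: fA fB; rewrite /free => /eqP -> /eqP ->.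
by rewrite !size_map -!cardE.
Qed.

Lemma vector_matroid (E : {set T}) : exists M : matroid E,
  forall A, (A \in indep M) = (A \subset E) && free [seq u i | i in A].
Proof.
pose ind := [set A : {set T} | (A \subset E) && free [seq u i | i in A]]%SET.
have h1 A : A \in ind -> A \subset E by rewrite inE => /andP[].
have h2 : finset.set0 \in ind.
  rewrite inE finset.sub0set /= (_ : [seq u i | i in finset.set0] = [::]) ?nil_free//.
  by apply: size0nil; rewrite size_map -cardE cards0.
have h3 (A B : {set T}) : B \in ind -> A \subset B -> A \in ind.
  rewrite !inE => /andP[BE fB] AB.
  by rewrite (fintype.subset_trans AB BE) (free_subset AB fB).
have h4 (A B : {set T}) : A \in ind -> B \in ind -> (#|A| < #|B|)%N ->
    exists2 x, x \in B :\: A & x |: A \in ind.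
  rewrite !inE => /andP[AE fA] /andP[BE fB] /(free_augment fA fB)[x xBA fx].
  exists x => //; rewrite inE fx andbT finset.subUset AE andbT finset.sub1set.
  by apply: (fintype.subsetP BE); move: xBA; rewrite inE => /andP[].
by exists (Matroid h1 h2 h3 h4) => A; rewrite inE.
Qed.

End VectorMatroid.

(** The [j]-th column lists the values of the [j]-th coordinate functional on the finite space [W].
    Functionals are independent exactly when their joint evaluation on [W] is onto. *)
Lemma free_coordinates (F : finFieldType) (d : nat) (W : {set 'rV[F]_d})
    (J : {set 'I_d}) :
  0 \in W -> (forall a w1 w2, w1 \in W -> w2 \in W -> a *: w1 + w2 \in W) ->
  free [seq (\col_(k < #|W|) (enum_val k : 'rV[F]_d) 0 j) | j in J] <->
  forall c : 'I_d -> F, exists2 w, w \in W & forall j, j \in J -> w 0 j = c j.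
Proof.
move=> W0 WD; set u := fun j : 'I_d => \col_(k < #|W|) (enum_val k : 'rV[F]_d) 0 j.
have szX : size [seq u j | j in J] == #|J| by rewrite size_image.
pose X := Tuple szX.
have Xn (l : 'I_#|J|) : X`_l = u (enum_val l).
  rewrite (nth_map (enum_val l)) -?cardE ?ltn_ord//.
  by rewrite -enum_val_nth.
rewrite -[X in free X]/(val X); split=> [/freeP fX c|hW].
  (* Its rows are the restrictions to [J] of the elements of [W]. Its columns are independent, so it
     has a left inverse, which gives the coefficients of the required combination. *)
  pose M : 'M[F]_(#|W|, #|J|) :=
    \matrix_(k, l) (enum_val k : 'rV[F]_d) 0 (enum_val l).
  have : row_free M^T.
    rewrite -kermx_eq0; apply: contraT => /rowV0Pn[w /sub_kermxP wM w0].
    case/negP: w0; apply/eqP/rowP => l; rewrite mxE; apply: fX.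
    apply/colP => k; rewrite summxE [RHS]mxE.
    have := congr1 (fun A : 'rV_#|W| => A 0 k) wM; rewrite [in RHS]mxE mxE => E.
    by rewrite -[RHS]E; apply: eq_bigr => i _; rewrite Xn !mxE.
  rewrite -row_leq_rank mxrank_tr col_leq_rank => /row_fullP[B BM].
  pose w0 := (\row_l c (enum_val l)) *m B.
  exists (\sum_k w0 0 k *: enum_val k).
    apply: (big_rec (fun w => w \in W)) => // k w _ hw; apply: WD => //.
    exact: enum_valP.
  move=> j jJ; rewrite summxE -(enum_rankK_in jJ jJ).
  have : w0 *m M = \row_l c (enum_val l) by rewrite -mulmxA BM mulmx1.
  move/rowP => /(_ (enum_rank_in jJ j)); rewrite [RHS]mxE [LHS]mxE => <-.
  by apply: eq_bigr => k _; rewrite !mxE.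
apply/freeP => a Xa l0.
(* The relation is evaluated at an element of [W] whose coordinates in [J] vanish except at [l0],
   where the coordinate is 1; this isolates one coefficient. *)
have [w wW hw] := hW (fun j => (j == enum_val l0)%:R).
have := congr1 (fun A : 'cV_#|W| => A (enum_rank_in wW w) 0) Xa.
rewrite summxE [in RHS]mxE (bigD1 l0)//= big1 => [|l ll0].
  by rewrite Xn !mxE enum_rankK_in// hw ?enum_valP// eqxx mulr1 addr0.
rewrite Xn !mxE enum_rankK_in// hw ?enum_valP//.
by rewrite (inj_eq enum_val_inj) (negbTE ll0) mulr0.
Qed.

(** * Reduction of a lattice modulo the maximal ideal *)

Section LatticeReduction.
Variables (K : topologicalFieldType) (v : K -> \bar int).
Hypothesis hv : discrete_valuation v.
Variables (d : nat) (L : set 'cV[K]_d).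
Hypothesis latL : lattice v L.

Definition product_coordinates (J : {set 'I_d}) : Prop :=
  forall h : 'I_d -> 'cV[K]_d, (forall j, j \in J -> L (h j)) ->
    exists2 y, L y & forall j, j \in J -> y j 0 = h j j 0.

Lemma lattice_bounded (j : 'I_d) :
  exists N : nat, forall y, L y -> vge v (- N%:Z) (y j 0).
Proof.
have [cL _ _ _] := latL; have [s _ hs] := compact_net_mx hv 0 cL.
have /choice [N hN] : forall x : 'cV[K]_d, exists N : nat, vge v (- N%:Z) (x j 0).
  by move=> x; exact: (vge_exists hv).
exists (\max_(x <- s) N x)%N => y /hs [x xs hx].
rewrite -[y j 0](subrK (x j 0)); apply: vgeD => //; first exact: vgeW (hx j).
apply: vgeW (hN x); rewrite lerN2 lez_nat.
exact: leq_bigmax_seq.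
Qed.

(* [t = 0] exactly when the [j]-th coordinate vanishes on [L]. *)
Lemma coordinate_generator (j : 'I_d) : exists t : K,
  (exists2 y, L y & y j 0 = t) /\
  forall y, L y -> exists2 a, vge v 0 a & y j 0 = a * t.
Proof.
have [cL L0 LD LZ] := latL.
have [nz|z] := pselect (exists2 y, L y & y j 0 != 0); last first.
  exists 0; split; first by exists 0; rewrite ?mxE.
  move=> y Ly; exists 0; rewrite ?mul0r ?(vge0 hv)//; apply/eqP.
  by apply: contrapT => /negP y0; apply: z; exists y.
have [N hN] := lattice_bounded j.
(* Valuations of the [j]-th coordinates are at least -N. Shifting by N makes them natural numbers,
   so a least one exists. *)
pose Q k := `[< exists2 y, L y & v (y j 0) = (k%:Z - N%:Z)%:E >].
have Qy y : L y -> y j 0 != 0 -> exists2 k, Q k & v (y j 0) = (k%:Z - N%:Z)%:E.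
  move=> Ly /(val_fin hv)[a E]; have := hN y Ly; rewrite /vge E lee_fin => Na.
  exists (absz (a + N%:Z)%R).
    by apply/asboolP; exists y => //; rewrite E; congr EFin; lia.
  by congr EFin; lia.
have exQ : exists k, Q k by have [y Ly /(Qy y Ly)[k Qk _]] := nz; exists k.
have [k /asboolP[x Lx vx] kmin] := ex_minnP exQ.
exists (x j 0); split; first by exists x.
move=> y Ly; exists (y j 0 / x j 0); last first.
  rewrite divfK//; apply/eqP => x0; move: vx.
  by rewrite x0 (valuation_eqy hv 0).2.
have x0 : x j 0 != 0.
  by apply/eqP => x0; move: vx; rewrite x0 (valuation_eqy hv 0).2.
rewrite -(vge_unscale hv _ _ vx) mulrCA divff// mulr1 addr0.
have [->|y0] := eqVneq (y j 0) 0; first exact: vge0.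
have [m Qm vy] := Qy y Ly y0.
by rewrite /vge vy lee_fin lerD2r lez_nat kmin.
Qed.

Variables (F : finFieldType) (red : K -> F).
Hypothesis red_surj : forall c, exists2 x, vge v 0 x & red x = c.
Hypothesis redD : forall x y, vge v 0 x -> vge v 0 y -> red (x + y) = red x + red y.
Hypothesis redM : forall x y, vge v 0 x -> vge v 0 y -> red (x * y) = red x * red y.
Hypothesis red_eq0 : forall x, vge v 0 x -> red x = 0 <-> vge v 1 x.

Lemma redB_eq0 x y : vge v 0 x -> vge v 0 y -> red x = red y -> vge v 1 (x - y).
Proof.
move=> x0 y0 xy; have xy0 : vge v 0 (x - y) by exact: vgeB.
by apply/(red_eq0 xy0)/(addIr (red y)); rewrite -redD// subrK add0r.
Qed.

Lemma vgeMO x y : vge v 0 x -> vge v 0 y -> vge v 0 (x * y).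
Proof. by move=> hx hy; have := vgeM hv hx hy; rewrite addr0. Qed.

Variable t : 'I_d -> K.
Hypothesis t_mem : forall j, exists2 y, L y & y j 0 = t j.
Hypothesis t_gen : forall j y, L y -> exists2 a, vge v 0 a & y j 0 = a * t j.

(* Coordinates with [t j = 0] are left free, so that they become coloops. *)
Definition reduction : {set 'rV[F]_d} := [set w : 'rV[F]_d |
  `[< exists2 y, L y & forall j a, t j != 0 -> vge v 0 a -> y j 0 = a * t j ->
        w 0 j = red a >]]%SET.

Lemma reduction0 : 0 \in reduction.
Proof.
have [_ L0 _ _] := latL; rewrite inE; apply/asboolP; exists 0 => // j a tj a0.
rewrite !mxE => /esym/eqP; rewrite mulf_eq0 (negbTE tj) orbF => /eqP ->.
by apply/esym/red_eq0; exact: vge0.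
Qed.

Lemma reduction_linear (c : F) (w1 w2 : 'rV[F]_d) :
  w1 \in reduction -> w2 \in reduction -> c *: w1 + w2 \in reduction.
Proof.
have [_ L0 LD LZ] := latL.
rewrite /reduction !finset.in_set => /asboolP w1W /asboolP w2W; apply/asboolP.
have [y1 Ly1 h1] := w1W; have [y2 Ly2 h2] := w2W.
have [x x0 <-] := red_surj c; exists (x *: y1 + y2).
  by apply: LD => //; apply: LZ.
move=> j a tj a0; rewrite !mxE.
have [a1 a10 E1] := t_gen j Ly1; have [a2 a20 E2] := t_gen j Ly2.
rewrite E1 E2 mulrA -mulrDl => /(mulIf tj) <-.
by rewrite redD ?vgeMO// redM// (h1 j a1)// (h2 j a2).
Qed.

(** Successive approximation: if the error is pi^n a_j t_j, the hypothesis gives z in [L] with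
    coordinates b_j t_j and b_j congruent to a_j modulo pi when t_j is nonzero. Subtracting pi^n z
    improves the precision by one. *)
Lemma product_coordinates_approx (J : {set 'I_d}) (n : nat) (h : 'I_d -> 'cV[K]_d) :
  (forall c : 'I_d -> F,
     exists2 w, w \in reduction & forall j, j \in J -> w 0 j = c j) ->
  (forall j, j \in J -> L (h j)) ->
  exists2 y, L y & forall j, j \in J ->
    exists2 b, vge v n%:Z b & y j 0 - h j j 0 = b * t j.
Proof.
move=> hW; have [_ L0 LD LZ] := latL; have [pi vpi] := valuation_surj hv 1.
have pi0 : pi != 0.
  by apply/eqP => pi0; move: vpi; rewrite pi0 (valuation_eqy hv 0).2.
have pin : vge v n%:Z (pi ^+ n).
  elim: n => [|n IH]; first by rewrite expr0 /vge (val1 hv).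
  rewrite exprS -(vge_unscale hv _ _ vpi) in IH *.
  by move: IH; congr (is_true (vge v _ _)); lia.
move=> hL.
suff [y Ly [a ha]] : exists2 y, L y & exists a : 'I_d -> K, forall j, j \in J ->
    vge v 0 (a j) /\ y j 0 - h j j 0 = pi ^+ n * a j * t j.
  exists y => // j jJ; have [aj E] := ha j jJ; exists (pi ^+ n * a j) => //.
  by have := vgeM hv pin aj; rewrite addr0.
elim: {pin} n => [|n [y Ly [a ha]]].
  have /choice [a ha] : forall j, exists a, j \in J -> vge v 0 a /\ h j j 0 = a * t j.
    move=> j; have [jJ|jJ] := boolP (j \in J); last by exists 0.
    by have [a a0 E] := t_gen j (hL j jJ); exists a.
  exists 0 => //; exists (fun j => - a j) => j /ha [a0 E].
  by rewrite (vgeN hv) E mxE expr0; split=> //; ring.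
have [w + hw] := hW (fun j => red (a j)).
rewrite inE => /asboolP[z Lz hz].
have /choice [b hb] : forall j, exists b, vge v 0 b /\ z j 0 = b * t j.
  by move=> j; have [b b0 E] := t_gen j Lz; exists b.
have vpin : vge v 0 (pi ^+ n).
  elim: n {ha} => [|n IH]; first by rewrite expr0 /vge (val1 hv).
  by rewrite exprS; apply: vgeMO => //; rewrite /vge vpi lee_fin.
exists (y - pi ^+ n *: z).
  by apply: (latticeB hv latL) => //; apply: LZ.
(* The new error coefficients. If t_j = 0, the coordinate vanishes on [L] and the error is already
   0. *)
exists (fun j => if t j == 0 then 0 else (a j - b j) / pi) => j jJ.
have [aj E] := ha j jJ; have [bj Ez] := hb j.
have [tj0|tj] := eqVneq (t j) 0.
  split; first exact: vge0.
  move: E; rewrite !mxE Ez tj0 !mulr0 subr0; exact: id.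
split.
  rewrite -(vge_unscale hv _ _ vpi) mulrCA divff// mulr1 addr0.
  by apply: redB_eq0 => //; rewrite -hw// (hz j (b j)).
rewrite !mxE Ez addrAC E exprS.
by field.
Qed.

(** Forwards, prescribed residues are lifted to multiples of the generators t_j and realised
    simultaneously. Backwards, approximations to every precision give an exact solution by
    compactness of [L]. *)
Lemma product_coordinatesP (J : {set 'I_d}) :
  product_coordinates J <->
  forall c : 'I_d -> F, exists2 w, w \in reduction & forall j, j \in J -> w 0 j = c j.
Proof.
have [cL L0 LD LZ] := latL; split=> [hJ c|hW h hL].
  have /choice [a ha] : forall j, exists a, vge v 0 a /\ red a = c j.
    by move=> j; have [a a0 E] := red_surj (c j); exists a.
  have /choice [g hg] : forall j, exists y, L y /\ y j 0 = t j.
    by move=> j; have [y Ly E] := t_mem j; exists y.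
  have [|y Ly hy] := hJ (fun j => a j *: g j).
    by move=> j _; apply: LZ; [exact: (ha j).1|exact: (hg j).1].
  have /choice [b hb] : forall j, exists b, vge v 0 b /\ y j 0 = b * t j.
    by move=> j; have [b b0 E] := t_gen j Ly; exists b.
  (* Coordinates with t_j = 0 are unconstrained in [reduction], so the prescribed value is simply
     inserted there. *)
  exists (\row_j if t j == 0 then c j else red (b j)).
    rewrite inE; apply/asboolP; exists y => // j a' tj a'0.
    by rewrite mxE (negbTE tj) (hb j).2 => /(mulIf tj) ->.
  move=> j jJ; rewrite mxE; have [//|tj] := eqVneq (t j) 0.
  have := hy j jJ; rewrite (hb j).2 mxE (hg j).2 => /(mulIf tj) ->.
  exact: (ha j).2.
apply: (@compact_approx _ _ hv d L (fun j => j \in J) (fun j => h j j 0) cL) => n.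
(* The t_j may have negative valuation, at least -N_j; the maximum of the N_j is added to the
   precision to compensate. *)
have /choice [N hN] := fun j => vge_exists hv (t j).
have [y Ly hy] := product_coordinates_approx (n + \max_j N j) hW hL.
exists y => // j /hy[b hb ->].
apply: vgeW (vgeM hv hb (hN j)); have := leq_bigmax (F := N) j; lia.
Qed.

End LatticeReduction.

(** * Independence given X_I as a condition on the fibre lattice *)

Section GaussianIndependence.
Variables (K : topologicalFieldType) (v : K -> \bar int).
Hypotheses (hv : discrete_valuation v) (hK : local_field K).
Variables (d : nat) (L : set 'cV[K]_d).
Hypothesis latL : lattice v L.
Context (R : realType) (disp : measure_display) (Omega : measurableType disp)
  (P : probability Omega R).
Variable X : {RV P >-> borel 'cV[K]_d}.
Hypothesis haarX : normalized_haar L (distribution P X).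

(** Forwards, the approximate points have a limit in [L] by compactness; its coordinates in [I]
    vanish exactly, so it lies in L0. Backwards, prescribing 0 at every coordinate of [J] but one
    gives [coordinates_split]. *)
Lemma independent_givenP (I J : {set 'I_d}) : J \subset (~: I)%SET ->
  independent_given P X I J <-> product_coordinates (fibre0 L I) J.
Proof.
have [cL _ _ _] := latL.
move=> /fintype.subsetP JI.
have nI j : j \in J -> j \notin I by move=> /JI; rewrite inE.
split=> [ind h hL0|hJ].
  have [|y Ly hy] := @compact_approx _ _ hv d L (fun i => i \in I :|: J)
      (fun i => if i \in I then 0 else h i i 0) cL.
    move=> n; have [z Lz [zI zJ]] := independent_approx hv latL haarX n ind hL0.
    exists z => // i; rewrite inE => /orP[iI|iJ]; first by rewrite iI subr0; exact: zI.
    by rewrite (negbTE (nI i iJ)); exact: zJ.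
  exists y.
    by split=> // i iI; rewrite hy ?iI// inE iI.
  by move=> j jJ; rewrite hy ?(negbTE (nI j jJ))// inE jJ orbT.
apply: (split_independent hv hK latL haarX) => j y jJ Ly.
have [_ L00 _ _] := fibre0_lattice hv latL I.
have [|y' Ly' hy'] := hJ (fun i => if i == j then y else 0).
  by move=> i _; case: ifP.
exists y' => //; split; first by rewrite hy'// eqxx.
by move=> i iJ /negbTE ij; rewrite hy'// ij mxE.
Qed.

End GaussianIndependence.

Theorem theorem1p2
    (K : topologicalFieldType) (hK : local_field K)
    (v : K -> \bar int) (hv : discrete_valuation v)
    (q : nat) (hq : is_module v q)
    (d : nat) (hd : (1 <= d)%N)
    (R : realType) (disp : measure_display) (Omega : measurableType disp)
    (P : probability Omega R)
    (X : {RV P >-> borel 'cV[K]_d}) (hX : gaussian_vector v X)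
    (I : {set 'I_d}) (hI : I \proper [set: 'I_d]) :
  exists M : matroid (~: I),
    Fq_realizable q M /\
    bases M = [set J : {set 'I_d} |
      maxset [pred J' : {set 'I_d} |
                (J' \subset ~: I) && `[< independent_given P X I J' >]] J]%SET.
Proof.
have [L latL haarX] := hX.
have latL0 := fibre0_lattice hv latL I.
have [F [red [cardF red_surj redD redM red_eq0]]] := residue_field hv hq.
have /choice [t ht] := coordinate_generator hv latL0.
have t_mem j := (ht j).1; have t_gen j := (ht j).2.
pose W := reduction v (fibre0 L I) red t.
pose u j : 'cV[F]_#|W| := \col_k (enum_val k : 'rV[F]_d) 0 j.
have [M indM] := vector_matroid u (~: I).
exists M; split.
  exists F, _, u; split=> // A AI.
  by rewrite indM AI.
(* Both families consist of maximal sets, so it suffices that the two underlying predicates agree on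
   every set. *)
apply/finset.setP => J; rewrite !inE; apply: maxset_eq => A /=.
rewrite indM; have [AI|//] := boolP (A \subset ~: I); rewrite /=.
apply/idP/asboolP.
  move/(free_coordinates _ (reduction0 hv latL0 red_eq0 t)
    (reduction_linear hv latL0 red_surj redD redM t_gen)).
  move/(product_coordinatesP hv latL0 red_surj redD red_eq0 t_mem t_gen).
  by move/(independent_givenP hv hK latL haarX AI).
move/(independent_givenP hv hK latL haarX AI).
move/(product_coordinatesP hv latL0 red_surj redD red_eq0 t_mem t_gen).
by move/(free_coordinates _ (reduction0 hv latL0 red_eq0 t)
  (reduction_linear hv latL0 red_surj redD redM t_gen)).
Qed.
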